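(* Let $0<\alpha\le 1$. Let $q,\tilde q$ be real-valued continuous functions on $[0,\pi]$ and $h,H,\tilde h,\tilde H\in\mathbb{R}$. Consider the boundary value problem $L_\alpha(q,h,H)$: $$-D_x^\alpha D_x^\alpha y+q(x)y=\lambda y,\ 0<x<\pi,\qquad D_x^\alpha y(0)-hy(0)=0,\qquad D_x^\alpha y(\pi)+Hy(\pi)=0,$$ and the analogous problem $L_\alpha(\tilde q,\tilde h,\tilde H)$. Let $M(\lambda)$ and $\tilde M(\lambda)$ be their respective Weyl functions (defined in the context). If $M(\lambda)=\tilde M(\lambda)$ (identically in $\lambda$), then $q(x)=\tilde q(x)$ a.e. on $[0,\pi]$, $h=\tilde h$ and $H=\tilde H$.
   Context: $D_x^\alpha$ denotes the conformable fractional derivative of order $\alpha$: for $x>0$, $D^\alpha f(x)=\lim_{\varepsilon\to 0}\frac{f(x+\varepsilon x^{1-\alpha})-f(x)}{\varepsilon}$, and $D^\alpha f(0)=\lim_{x\to0^+}D^\alpha f(x)$ (for differentiable $f$, $D^\alpha f(x)=x^{1-\alpha}f'(x)$). $\lambda$ is a complex spectral parameter. For the problem $L_\alpha(q,h,H)$, let $\varphi(x,\lambda)$ and $\psi(x,\lambda)$ be the solutions of $-D_x^\alpha D_x^\alpha y+q(x)y=\lambda y$ satisfying $\varphi(0,\lambda)=1$, $D_x^\alpha\varphi(0,\lambda)=h$ and $\psi(\pi,\lambda)=1$, $D_x^\alpha\psi(\pi,\lambda)=-H$. Let $\Delta(\lambda)=\psi(x,\lambda)D_x^\alpha\varphi(x,\lambda)-\varphi(x,\lambda)D_x^\alpha\psi(x,\lambda)$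 (independent of $x$; equal to $D_x^\alpha\varphi(\pi,\lambda)+H\varphi(\pi,\lambda)$). The Weyl function is $M(\lambda)=-\psi(0,\lambda)/\Delta(\lambda)$. Objects with a tilde are defined analogously for $L_\alpha(\tilde q,\tilde h,\tilde H)$. *)

(* Defs.v *)
From Stdlib Require Import Reals.
From Coquelicot Require Import Coquelicot.

Open Scope R_scope.

Definition is_cfd (a : R) (f : R -> C) (x : R) (l : C) : Prop :=
  filterlim (fun eps : R => scal (/ eps) (minus (f (x + eps * Rpower x (1 - a))) (f x)))
            (locally' 0) (locally l).

Definition Ipi (x : R) : Prop := 0 <= x <= PI.

Definition cont_on_Ipi {V : UniformSpace} (f : R -> V) : Prop :=
  forall x, Ipi x -> filterlim f (within Ipi (locally x)) (locally (f x)).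

(* y is a solution on (0,pi) of  -D^a D^a y + q y = lam y, and Dy is its
   conformable derivative D^a y: on (0,pi) it is the conformable derivative,
   and Dy 0, Dy pi are the one-sided limits (Dy is continuous on [0,pi]),
   which is how D^a y(0) = lim_{x->0+} D^a y(x) is defined (and likewise at pi). *)
Definition is_sol (a : R) (q : R -> R) (lam : C) (y Dy : R -> C) : Prop :=
  cont_on_Ipi y /\ cont_on_Ipi Dy /\
  (forall x, 0 < x < PI -> is_cfd a y x (Dy x)) /\
  (forall x, 0 < x < PI -> exists D2 : C,
       is_cfd a Dy x D2 /\
       Cplus (Copp D2) (Cmult (RtoC (q x)) (y x)) = Cmult lam (y x)).

Definition is_phi (a : R) (q : R -> R) (h : R) (phi Dphi : R -> C -> C) : Prop :=
  forall lam : C, is_sol a q lam (fun x => phi x lam) (fun x => Dphi x lam) /\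
    phi 0 lam = RtoC 1 /\ Dphi 0 lam = RtoC h.

Definition is_psi (a : R) (q : R -> R) (H : R) (psi Dpsi : R -> C -> C) : Prop :=
  forall lam : C, is_sol a q lam (fun x => psi x lam) (fun x => Dpsi x lam) /\
    psi PI lam = RtoC 1 /\ Dpsi PI lam = RtoC (- H).

Definition DeltaW (H : R) (phi Dphi : R -> C -> C) (lam : C) : C :=
  Cplus (Dphi PI lam) (Cmult (RtoC H) (phi PI lam)).

Definition Weyl (H : R) (phi Dphi psi : R -> C -> C) (lam : C) : C :=
  Copp (Cdiv (psi 0 lam) (DeltaW H phi Dphi lam)).

(* Main.v *)
Require Import Defs.
From Stdlib Require Import Reals Lra Psatz List.
From Coquelicot Require Import Coquelicot.
Open Scope R_scope.

(** The variable [r = T - x^a / a], [T = PI^a / a], turns the equation for [psi] at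
    [lam = - k^2] into [Y'' = (Q + k^2) Y], [Y(0) = 1], [Y'(0) = H]. For large real [k]
    both [Delta]s are nonzero, and equality of the Weyl functions says, by the Wronskian,
    [int_0^T (Q - Qt) Y_k Yt_k = (Ht - H) + (ht - h) Y_k(T) Yt_k(T)].
    If [f(s) = sum c_j cosh (k_j s)], then [sum c_j Y_{k_j}(r) cosh (k_j s)] solves the
    wave equation [u_rr = u_ss + Q u] with data [f], [H f], so an energy estimate in the
    characteristic cone gives [|u - (f(s + r) + f(s - r)) / 2| <= C int_{s-r}^{s+r} |f|].
    Used twice, it shows that [sum c_j Y_{k_j}(r) Yt_{k_j}(r)] is [(f(2r) + f(0)) / 2] up to
    [K int_0^{2r} |f|]. Such [f] are uniformly dense in the continuous functions on [[0, 2T]],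
    so the Wronskian identity becomes an inequality for arbitrary continuous [g]. Peaks at
    [2T] give [h = ht]; peaks at [2r] give [|V(r)| <= 4 K int_r^T |V|] for [V = Q - Qt],
    hence [V = 0] by Gronwall; finally [g = 1] gives [H = Ht]. *)

(** Equality of the Weyl functions is assumed only where neither [Delta] vanishes, and a zero is
    excluded only for real [k] beyond a threshold. Hence no low frequency may occur in any
    approximation, and density is needed for the [cosh (k s)] with [k >= k0] only. No integral
    kernel for [Y_k] is constructed: only the distance to the free wave is estimated, by the [L^1]
    norm of the data and with a constant independent of the sum. The [L^1] norm is what makes peaks
    useful: a peak of height 1 and width [e] keeps its point value while its norm is of order [e].
    That isolates the boundary term at [2 T]; at an interior point both sides carry the mass of the
    peak as a factor, which cancels. The integral stopping at [2 r] expresses finite propagation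
    speed. It makes the last inequality one of Volterra type, so that Gronwall applies however large
    [K] is. The variable [r] starts at [x = PI], where [psi] is normalized; [psi(0)] is then [Y(T)],
    and a Wronskian expresses [Delta] by [Y(T)] and [Y'(T)] as well. *)

(** * Monotonicity and integrals on the real line *)

Lemma nondecreasing_of_derive (f df : R -> R) (x y : R) :
  x <= y -> (forall t, x <= t <= y -> is_derive f t (df t)) ->
  (forall t, x <= t <= y -> 0 <= df t) -> f x <= f y.
Proof.
intros xy Df df0.
destruct (MVT_gen f x y df) as [c [hc e]].
- intros t ht; rewrite Rmin_left, Rmax_right in ht by lra; apply Df; lra.
- intros t ht; rewrite Rmin_left, Rmax_right in ht by lra.
  apply continuity_pt_filterlim, (ex_derive_continuous f).
  exists (df t); apply Df; lra.
- rewrite Rmin_left, Rmax_right in hc by lra.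
  specialize (df0 c hc); nra.
Qed.

Lemma constant_of_derive_zero (f : R -> R) (x y : R) :
  x <= y -> (forall t, x <= t <= y -> is_derive f t 0) -> f y = f x.
Proof.
intros xy Df; apply Rle_antisym.
- apply Ropp_le_cancel.
  apply (nondecreasing_of_derive (fun t => - f t) (fun _ => 0)); try (intros; lra).
  intros t ht; replace 0 with (- 0) by ring.
  apply (is_derive_opp f), Df; lra.
- apply (nondecreasing_of_derive f (fun _ => 0)); try (intros; lra); exact Df.
Qed.

Lemma ex_RInt_continuous_everywhere (f : R -> R) (x y : R) :
  (forall t, continuous f t) -> ex_RInt f x y.
Proof. intros cf; apply (ex_RInt_continuous f); auto. Qed.

Lemma continuous_Rabs_comp (f : R -> R) (x : R) :
  continuous f x -> continuous (fun t => Rabs (f t)) x.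
Proof. intros cf; exact (continuous_comp f Rabs x cf (continuous_Rabs (f x))). Qed.

Lemma RInt_nonneg (f : R -> R) (x y : R) :
  x <= y -> (forall t, continuous f t) -> (forall t, 0 <= f t) -> 0 <= RInt f x y.
Proof.
intros xy cf f0; apply RInt_ge_0; auto.
apply ex_RInt_continuous_everywhere; auto.
Qed.

Lemma RInt_le_subinterval (f : R -> R) (x y x' y' : R) :
  x <= x' -> x' <= y' -> y' <= y ->
  (forall t, continuous f t) -> (forall t, 0 <= f t) ->
  RInt f x' y' <= RInt f x y.
Proof.
intros h1 h2 h3 cf f0.
assert (ex : forall u v, ex_RInt f u v)
  by (intros; apply ex_RInt_continuous_everywhere; auto).
rewrite <- (RInt_Chasles f x x' y) by auto.
rewrite <- (RInt_Chasles f x' y' y) by auto.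
pose proof (RInt_nonneg f x x' h1 cf f0).
pose proof (RInt_nonneg f y' y h3 cf f0).
unfold plus; simpl; lra.
Qed.

Lemma RInt_Rabs_le (f : R -> R) (x y : R) :
  x <= y -> ex_RInt f x y -> Rabs (RInt f x y) <= RInt (fun t => Rabs (f t)) x y.
Proof. intros; apply abs_RInt_le; auto. Qed.

Lemma RInt_le_on (f g : R -> R) (x y : R) :
  x <= y -> ex_RInt f x y -> ex_RInt g x y ->
  (forall t, x <= t <= y -> f t <= g t) -> RInt f x y <= RInt g x y.
Proof. intros; apply RInt_le; auto; intros; apply H2; lra. Qed.

Lemma RInt_of_derive_closed (f df : R -> R) (x y : R) :
  x <= y -> (forall t, x <= t <= y -> is_derive f t (df t)) ->
  (forall t, x <= t <= y -> continuous df t) -> is_RInt df x y (f y - f x).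
Proof.
intros xy Df cdf; apply (is_RInt_derive f df);
  rewrite Rmin_left, Rmax_right by lra; auto.
Qed.

Lemma continuous_bounded (f : R -> R) (x y : R) :
  x <= y -> (forall t, x <= t <= y -> continuous f t) ->
  exists M, 0 <= M /\ forall t, x <= t <= y -> Rabs (f t) <= M.
Proof.
intros xy cf.
destruct (continuity_ab_maj (fun t => Rabs (f t)) x y xy) as [m [hm _]].
- intros t ht; apply continuity_pt_filterlim, continuous_Rabs_comp, cf, ht.
- exists (Rabs (f m)); split; [apply Rabs_pos | exact hm].
Qed.

(** * The wave equation behind the solutions *)

(** The derivatives are two-sided even at [0] and [T]; [reg_Y] and [reg_Z] are built to supply
    this. *)
Definition ode_sol (T k : R) (Q Y Z : R -> R) : Prop :=
  forall r, 0 <= r <= T ->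
    is_derive Y r (Z r) /\ is_derive Z r ((Q r + k ^ 2) * Y r).

Lemma ode_sol_continuous (T k : R) (Q Y Z : R -> R) (r : R) :
  ode_sol T k Q Y Z -> 0 <= r <= T -> continuous Y r /\ continuous Z r.
Proof.
intros S hr; destruct (S r hr) as [DY DZ].
split; [apply (ex_derive_continuous Y) | apply (ex_derive_continuous Z)];
  eexists; eauto.
Qed.

Lemma is_derive_cosh_scal (k x : R) :
  is_derive (fun t => cosh (k * t)) x (k * sinh (k * x)).
Proof. unfold cosh, sinh; auto_derive; [trivial | field]. Qed.

Lemma continuous_cosh_scal (k x : R) : continuous (fun t => cosh (k * t)) x.
Proof.
apply (ex_derive_continuous (fun t => cosh (k * t))).
eexists; apply is_derive_cosh_scal.
Qed.

Lemma sinh_plus (x y : R) : sinh (x + y) = sinh x * cosh y + cosh x * sinh y.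
Proof. unfold sinh, cosh; rewrite Ropp_plus_distr, !exp_plus; field. Qed.

Lemma cosh_plus (x y : R) : cosh (x + y) = cosh x * cosh y + sinh x * sinh y.
Proof. unfold sinh, cosh; rewrite Ropp_plus_distr, !exp_plus; field. Qed.

Lemma sinh_opp (x : R) : sinh (- x) = - sinh x.
Proof. unfold sinh; rewrite Ropp_involutive; field. Qed.

Lemma cosh_opp (x : R) : cosh (- x) = cosh x.
Proof. unfold cosh; rewrite Ropp_involutive; field. Qed.

Lemma is_RInt_cosh_scal (k x y : R) :
  k <> 0 -> is_RInt (fun t => cosh (k * t)) x y ((sinh (k * y) - sinh (k * x)) / k).
Proof.
intros k0.
replace ((sinh (k * y) - sinh (k * x)) / k)
  with (minus (sinh (k * y) / k) (sinh (k * x) / k))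
  by (unfold minus, plus, opp; simpl; field; auto).
apply (is_RInt_derive (fun t => sinh (k * t) / k) (fun t => cosh (k * t))).
- intros t _; unfold cosh, sinh; auto_derive; [trivial | field; auto].
- intros t _; apply continuous_cosh_scal.
Qed.

(* Variation of constants, multiplied by [cosh (k s)]: by the addition formulas it
   becomes d'Alembert's formula for [u(r, s) = Y(r) cosh (k s)]. *)
Lemma duhamel (T k : R) (Q Y Z : R -> R) (r s : R) :
  k <> 0 -> (forall t, continuous Q t) -> ode_sol T k Q Y Z -> Y 0 = 1 -> 0 <= r <= T ->
  is_RInt (fun p => Q p * (Y p *
      ((sinh (k * (s + (r - p))) - sinh (k * (s - (r - p)))) / k))) 0 r
    (2 * (Y r * cosh (k * s)) - cosh (k * (s + r)) - cosh (k * (s - r))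
     - Z 0 * ((sinh (k * (s + r)) - sinh (k * (s - r))) / k)).
Proof.
intros k0 cQ S Y0 hr.
(* Free propagation of [(Y, Z)] from [p] to [r]: constant in [p] when [Q = 0], so that its
   derivative retains only the [Q] term. *)
pose (G := fun p => 2 * cosh (k * s) *
   (cosh (k * (r - p)) * Y p + sinh (k * (r - p)) / k * Z p)).
assert (E : forall p, (sinh (k * (s + p)) - sinh (k * (s - p))) / k
                 = 2 * cosh (k * s) * (sinh (k * p) / k)).
{ intros p.
  replace (k * (s + p)) with (k * s + k * p) by ring.
  replace (k * (s - p)) with (k * s + - (k * p)) by ring.
  rewrite !sinh_plus, cosh_opp, sinh_opp; field; auto. }
assert (I : is_RInt (fun p => 2 * cosh (k * s) * (sinh (k * (r - p)) / k) * (Q p * Y p))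
                    0 r (G r - G 0)).
{ apply RInt_of_derive_closed; [lra | |].
  - intros p hp; destruct (S p) as [DY DZ]; [lra |].
    unfold G, cosh, sinh; auto_derive.
    + repeat split; auto; [exists (Z p); auto | eexists; exact DZ].
    + replace (Derive (fun x : R => Y x) p) with (Z p)
        by (symmetry; apply is_derive_unique; exact DY).
      replace (Derive (fun x : R => Z x) p) with ((Q p + k ^ 2) * Y p)
        by (symmetry; apply is_derive_unique; exact DZ).
      unfold Rminus; field; auto.
  - intros p hp; destruct (ode_sol_continuous _ _ _ _ _ p S) as [cY cZ]; [lra |].
    apply (continuous_mult (fun p => 2 * cosh (k * s) * (sinh (k * (r - p)) / k))).
    + apply (ex_derive_continuous (fun p => 2 * cosh (k * s) * (sinh (k * (r - p)) / k))).
      unfold sinh; auto_derive; trivial.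
    + apply (continuous_mult Q); auto. }
replace (_ - _ - _ - _) with (G r - G 0).
- apply (is_RInt_ext (V := R_NormedModule)) with (2 := I); intros p _; rewrite E; simpl; ring.
- unfold G; rewrite E, Y0, Rminus_diag, Rmult_0_r, cosh_0, sinh_0, Rminus_0_r.
  replace (k * (s + r)) with (k * s + k * r) by ring.
  replace (k * (s - r)) with (k * s + - (k * r)) by ring.
  rewrite !cosh_plus, cosh_opp, sinh_opp; field; auto.
Qed.

(* A pair [(c, k)] is a coefficient with its frequency. *)
Definition lsum (l : list (R * R)) (F : R -> R) : R :=
  fold_right (fun p acc => fst p * F (snd p) + acc) 0 l.

Definition freq_ge (k0 : R) (l : list (R * R)) : Prop :=
  forall p, In p l -> k0 <= snd p.

Lemma lsum_ext (k0 : R) (l : list (R * R)) (F G : R -> R) :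
  freq_ge k0 l -> (forall k, k0 <= k -> F k = G k) -> lsum l F = lsum l G.
Proof.
intros hl FG; induction l as [|p l IH]; simpl; auto.
rewrite IH, FG; auto; [apply hl; simpl; auto | intros q hq; apply hl; simpl; auto].
Qed.

Lemma lsum_plus (l : list (R * R)) (F G : R -> R) :
  lsum l (fun k => F k + G k) = lsum l F + lsum l G.
Proof. induction l as [|p l IH]; simpl; [ring | rewrite IH; ring]. Qed.

Lemma lsum_scal (l : list (R * R)) (c : R) (F : R -> R) :
  lsum l (fun k => c * F k) = c * lsum l F.
Proof. induction l as [|p l IH]; simpl; [ring | rewrite IH; ring]. Qed.

Lemma lsum_reweight (l : list (R * R)) (w F : R -> R) :
  lsum (map (fun p => (fst p * w (snd p), snd p)) l) F = lsum l (fun k => w k * F k).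
Proof. induction l as [|p l IH]; simpl; [ring | rewrite IH; ring]. Qed.

Lemma freq_ge_reweight (k0 : R) (l : list (R * R)) (w : R -> R) :
  freq_ge k0 l -> freq_ge k0 (map (fun p => (fst p * w (snd p), snd p)) l).
Proof.
intros hl p hp; apply in_map_iff in hp; destruct hp as [x [<- hx]]; apply (hl x hx).
Qed.

Lemma is_RInt_lsum (k0 : R) (l : list (R * R)) (G : R -> R -> R) (I : R -> R) (x y : R) :
  freq_ge k0 l -> (forall k, k0 <= k -> is_RInt (G k) x y (I k)) ->
  is_RInt (fun t => lsum l (fun k => G k t)) x y (lsum l I).
Proof.
intros hl HG; induction l as [|p l IH]; simpl.
- pose proof (is_RInt_const x y 0) as C.
  unfold scal in C; simpl in C; unfold mult in C; simpl in C.
  rewrite Rmult_0_r in C; exact C.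
- apply (is_RInt_plus (V := R_NormedModule)
    (fun t => fst p * G (snd p) t) (fun t => lsum l (fun k => G k t))).
  + apply (is_RInt_scal (V := R_NormedModule) (G (snd p))), HG, hl; simpl; auto.
  + apply IH; intros q hq; apply hl; simpl; auto.
Qed.

Lemma continuous_lsum (l : list (R * R)) (G : R -> R -> R) (x : R) :
  (forall k, continuous (G k) x) -> continuous (fun t => lsum l (fun k => G k t)) x.
Proof.
intros HG; induction l as [|p l IH]; simpl.
- apply continuous_const.
- apply (continuous_plus (V := R_NormedModule) (fun t => fst p * G (snd p) t)
    (fun t => lsum l (fun k => G k t))); auto.
  apply (continuous_mult (fun _ => fst p)); auto; apply continuous_const.
Qed.

Definition cosh_sum (l : list (R * R)) (s : R) : R := lsum l (fun k => cosh (k * s)).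

Lemma continuous_cosh_sum (l : list (R * R)) (s : R) : continuous (cosh_sum l) s.
Proof. apply (continuous_lsum l (fun k s => cosh (k * s))); intros; apply continuous_cosh_scal. Qed.

Lemma cosh_sum_opp (l : list (R * R)) (s : R) : cosh_sum l (- s) = cosh_sum l s.
Proof.
unfold cosh_sum; induction l as [|p l IH]; simpl; auto.
rewrite IH; replace (snd p * - s) with (- (snd p * s)) by ring.
rewrite cosh_opp; auto.
Qed.

Lemma is_RInt_cosh_sum (k0 : R) (l : list (R * R)) (x y : R) :
  0 < k0 -> freq_ge k0 l ->
  is_RInt (cosh_sum l) x y (lsum l (fun k => (sinh (k * y) - sinh (k * x)) / k)).
Proof.
intros k0p hl; apply (is_RInt_lsum k0 l (fun k s => cosh (k * s))); auto.
intros k hk; apply is_RInt_cosh_scal; lra.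
Qed.

(** At each time [r] the wave is again a finite sum of hyperbolic cosines in [s], with the same
    frequencies, so it can itself serve as initial data; [product_bound] relies on this. *)
Definition wave (l : list (R * R)) (Y : R -> R -> R) (r : R) : list (R * R) :=
  map (fun p => (fst p * Y (snd p) r, snd p)) l.

Lemma cosh_sum_wave (l : list (R * R)) (Y : R -> R -> R) (r s : R) :
  cosh_sum (wave l Y r) s = lsum l (fun k => Y k r * cosh (k * s)).
Proof. apply (lsum_reweight l (fun k => Y k r)). Qed.

Lemma freq_ge_wave (k0 : R) (l : list (R * R)) (Y : R -> R -> R) (r : R) :
  freq_ge k0 l -> freq_ge k0 (wave l Y r).
Proof. exact (freq_ge_reweight k0 l (fun k => Y k r)). Qed.

Definition sol_family (T k0 H : R) (Q : R -> R) (Y Z : R -> R -> R) : Prop :=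
  forall k, k0 <= k -> ode_sol T k Q (Y k) (Z k) /\ Y k 0 = 1 /\ Z k 0 = H.

(** The quotients of [sinh] by [k] are integrals of [cosh]. After summation the frequencies
    disappear, and only the data and the wave occur: d'Alembert's formula with source [Q u] over the
    characteristic triangle. *)
Lemma duhamel_wave (T k0 H : R) (Q : R -> R) (Y Z : R -> R -> R)
    (l : list (R * R)) (r s : R) :
  0 < k0 -> (forall t, continuous Q t) -> sol_family T k0 H Q Y Z ->
  freq_ge k0 l -> 0 <= r <= T ->
  is_RInt (fun p => Q p * RInt (cosh_sum (wave l Y p)) (s - (r - p)) (s + (r - p))) 0 r
    (2 * cosh_sum (wave l Y r) s - cosh_sum l (s + r) - cosh_sum l (s - r)
     - H * RInt (cosh_sum l) (s - r) (s + r)).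
Proof.
intros k0p cQ S hl hr.
rewrite cosh_sum_wave.
rewrite (is_RInt_unique _ _ _ _ (is_RInt_cosh_sum k0 l (s - r) (s + r) k0p hl)).
apply (is_RInt_ext (V := R_NormedModule)) with
  (f := fun p => lsum l (fun k => Q p * (Y k p *
      ((sinh (k * (s + (r - p))) - sinh (k * (s - (r - p)))) / k)))).
{ intros p _.
  rewrite (is_RInt_unique _ _ _ _
    (is_RInt_cosh_sum k0 (wave l Y p) _ _ k0p (freq_ge_wave _ _ _ _ hl))).
  unfold wave; rewrite (lsum_reweight l (fun k => Y k p)), lsum_scal; auto. }
replace (_ - _ - _ - _) with
  (lsum l (fun k => 2 * (Y k r * cosh (k * s)) + (-1) * cosh (k * (s + r))
     + (-1) * cosh (k * (s - r))
     + (- H) * ((sinh (k * (s + r)) - sinh (k * (s - r))) / k))).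
2:{ unfold cosh_sum; rewrite !lsum_plus, !lsum_scal; ring. }
apply (is_RInt_lsum k0 l (fun k p => Q p * (Y k p *
      ((sinh (k * (s + (r - p))) - sinh (k * (s - (r - p)))) / k)))); auto.
intros k hk; destruct (S k hk) as [Sk [Y0 Z0]].
replace (_ + _ + _ + _) with
  (2 * (Y k r * cosh (k * s)) - cosh (k * (s + r)) - cosh (k * (s - r))
     - Z k 0 * ((sinh (k * (s + r)) - sinh (k * (s - r))) / k)) by (rewrite Z0; ring).
apply (duhamel T); auto; lra.
Qed.

(** The least upper bound [A] satisfies [A <= B + A / 2]. The crude bound [A0] only guarantees that
    [A] is finite and leaves no trace in the result; no regularity of [g] is needed. *)
Lemma bound_of_halving (g : R -> R) (r A0 B : R) :
  (forall p, 0 <= p <= r -> g p <= A0) ->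
  (forall A, (forall p, 0 <= p <= r -> g p <= A) ->
     forall p, 0 <= p <= r -> g p <= B + A / 2) ->
  forall p, 0 <= p <= r -> g p <= 2 * B.
Proof.
intros h0 step p hp.
destruct (completeness (fun y => exists t, 0 <= t <= r /\ y = g t)) as [A [ub lub]].
- exists A0; intros y [t [ht ->]]; auto.
- exists (g p); exists p; auto.
- assert (hA : forall t, 0 <= t <= r -> g t <= A) by (intros t ht; apply ub; exists t; auto).
  assert (A <= B + A / 2).
  { apply lub; intros y [t [ht ->]]; apply step; auto. }
  specialize (hA p hp); lra.
Qed.

Lemma wave_bounded (T k0 H : R) (Q : R -> R) (Y Z : R -> R -> R)
    (l : list (R * R)) (x y : R) :
  sol_family T k0 H Q Y Z -> freq_ge k0 l -> 0 <= T -> x <= y ->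
  exists M, 0 <= M /\ forall p s, 0 <= p <= T -> x <= s <= y ->
    Rabs (cosh_sum (wave l Y p) s) <= M.
Proof.
intros S hl T0 xy; induction l as [|[c k] l IH].
- exists 0; split; [lra |]; intros; unfold cosh_sum; simpl; rewrite Rabs_R0; lra.
- destruct IH as [M [M0 hM]]; [intros q hq; apply hl; simpl; auto |].
  assert (hk : k0 <= k) by (apply (hl (c, k)); simpl; auto).
  destruct (S k hk) as [Sk _].
  destruct (continuous_bounded (Y k) 0 T T0) as [M1 [M10 hM1]].
  { intros t ht; apply (ode_sol_continuous _ _ _ _ _ t Sk ht). }
  destruct (continuous_bounded (fun s => cosh (k * s)) x y xy) as [M2 [M20 hM2]].
  { intros t _; apply continuous_cosh_scal. }
  exists (Rabs c * M1 * M2 + M); split.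
  + pose proof (Rabs_pos c).
    assert (0 <= Rabs c * M1) by (apply Rmult_le_pos; auto).
    assert (0 <= Rabs c * M1 * M2) by (apply Rmult_le_pos; auto); lra.
  + intros p s hp hs; unfold cosh_sum; simpl.
    eapply Rle_trans; [apply Rabs_triang |].
    apply Rplus_le_compat; [| apply hM; auto].
    rewrite !Rabs_mult.
    apply Rmult_le_compat; auto using Rabs_pos.
    * apply Rmult_le_pos; apply Rabs_pos.
    * apply Rmult_le_compat_l; auto using Rabs_pos.
Qed.

Lemma continuous_Rabs_cosh_sum (l : list (R * R)) (s : R) :
  continuous (fun t => Rabs (cosh_sum l t)) s.
Proof. apply continuous_Rabs_comp, continuous_cosh_sum. Qed.

Lemma RInt_Rabs_shift_le (f : R -> R) (b x y x' y' : R) :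
  (forall t, continuous f t) -> x <= y -> x' <= x + b -> y + b <= y' ->
  RInt (fun t => Rabs (f (t + b))) x y <= RInt (fun t => Rabs (f t)) x' y'.
Proof.
intros cf xy hx hy.
assert (E : RInt (fun t => Rabs (f (t + b))) x y = RInt (fun t => Rabs (f t)) (x + b) (y + b)).
{ replace (x + b) with (1 * x + b) by ring; replace (y + b) with (1 * y + b) by ring.
  rewrite <- (RInt_comp_lin (V := R_CompleteNormedModule) (fun t => Rabs (f t)) 1 b x y).
  - apply RInt_ext; intros t _; unfold scal; simpl; unfold mult; simpl.
    rewrite !Rmult_1_l; auto.
  - apply ex_RInt_continuous_everywhere; intros; apply continuous_Rabs_comp; auto. }
rewrite E; apply RInt_le_subinterval; try lra.
- intros; apply continuous_Rabs_comp; auto.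
- intros; apply Rabs_pos.
Qed.

(** The translates of [[x, y]] by [b] and [- b] both stay in [[x - b, y + b]], so averaging them
    does not increase the [L^1] norm. *)
Lemma RInt_Rabs_average_le (f w : R -> R) (b D x y : R) :
  (forall t, continuous f t) -> (forall t, continuous w t) -> 0 <= b -> x <= y ->
  (forall t, x <= t <= y -> Rabs (w t - (f (t + b) + f (t - b)) / 2) <= D) ->
  RInt (fun t => Rabs (w t)) x y <=
    RInt (fun t => Rabs (f t)) (x - b) (y + b) + (y - x) * D.
Proof.
intros cf cw b0 xy hD.
assert (ex : forall b, ex_RInt (fun t => Rabs (f (t + b))) x y).
{ intros c; apply ex_RInt_continuous_everywhere; intros t.
  apply continuous_Rabs_comp, (continuous_comp (fun t => t + c) f); auto.
  apply (continuous_plus (V := R_NormedModule)); [apply continuous_id | apply continuous_const]. }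
assert (ex2 : ex_RInt (fun t => Rabs (f (t + b)) + Rabs (f (t + - b))) x y)
  by (apply (ex_RInt_plus (V := R_NormedModule)); auto).
assert (ex3 : ex_RInt (fun t => / 2 * (Rabs (f (t + b)) + Rabs (f (t + - b)))) x y)
  by exact (ex_RInt_scal (V := R_NormedModule) _ _ _ _ ex2).
assert (N1 : RInt (fun t => Rabs (w t)) x y <=
  RInt (fun t => / 2 * (Rabs (f (t + b)) + Rabs (f (t + - b))) + D) x y).
{ apply RInt_le_on; auto.
  - apply ex_RInt_continuous_everywhere; intros; apply continuous_Rabs_comp; auto.
  - apply (ex_RInt_plus (V := R_NormedModule)); auto; apply ex_RInt_const.
  - intros t ht; specialize (hD t ht); unfold Rminus in hD.
    apply Rabs_le_between in hD.
    pose proof (proj1 (Rabs_le_between (f (t + b)) _) (Rle_refl _)).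
    pose proof (proj1 (Rabs_le_between (f (t + - b)) _) (Rle_refl _)).
    apply Rabs_le_between; lra. }
rewrite (RInt_plus (V := R_CompleteNormedModule) _ (fun _ => D)) in N1
  by (auto; apply ex_RInt_const).
rewrite (RInt_scal (V := R_CompleteNormedModule)
  (fun t => Rabs (f (t + b)) + Rabs (f (t + - b)))) in N1 by auto.
rewrite (RInt_plus (V := R_CompleteNormedModule)), RInt_const in N1 by auto.
unfold plus, scal in N1; simpl in N1; unfold mult in N1; simpl in N1.
assert (S1 : RInt (fun t => Rabs (f (t + b))) x y <=
             RInt (fun t => Rabs (f t)) (x - b) (y + b))
  by (apply RInt_Rabs_shift_le; auto; lra).
assert (S2 : RInt (fun t => Rabs (f (t + - b))) x y <=
             RInt (fun t => Rabs (f t)) (x - b) (y + b))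
  by (apply RInt_Rabs_shift_le; auto; lra).
lra.
Qed.

(** * Energy estimate in the characteristic cone *)

(** Rate of the exponential weight, large enough for [T * Qm / L <= 1 / 2]; the summand 1 keeps it
    positive when [Qm] or [T] is 0. *)
Definition cone_rate (T Qm : R) : R := 2 * T * Qm + 1.

Section Cone.
Variables (T k0 H Qm : R) (Q : R -> R) (Y Z : R -> R -> R) (l : list (R * R)) (r s : R).
Hypotheses (k0p : 0 < k0) (cQ : forall t, continuous Q t)
  (Qb : forall t, 0 <= t <= T -> Rabs (Q t) <= Qm)
  (S : sol_family T k0 H Q Y Z) (hl : freq_ge k0 l) (hr : 0 <= r <= T).

Let u (p x : R) : R := cosh_sum (wave l Y p) x.
Let f : R -> R := cosh_sum l.
Let F : R := RInt (fun t => Rabs (f t)) (s - r) (s + r).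
(** The energy: the [L^1] norm of the wave on the slice at height [p] of the cone with apex
    [(r, s)]. [F] is its value on the base. *)
Let N (p : R) : R := RInt (fun t => Rabs (u p t)) (s - (r - p)) (s + (r - p)).
Let L : R := cone_rate T Qm.

Lemma cone_Qm_nonneg : 0 <= Qm.
Proof. eapply Rle_trans; [apply Rabs_pos | apply (Qb 0); lra]. Qed.

Lemma cone_rate_ge1 : 1 <= L.
Proof. pose proof cone_Qm_nonneg; unfold L, cone_rate; nra. Qed.

(** The smaller cone with apex [(p, x)] lies in the large one, so the assumed growth of [N] bounds
    the source on each of its slices. Integrating the exponential gains the factor [1 / L]; the 2
    comes from d'Alembert's formula. *)
Lemma cone_pointwise (A p x : R) :
  0 <= A -> (forall p', 0 <= p' <= r -> N p' <= A * exp (L * p')) ->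
  0 <= p <= r -> s - (r - p) <= x <= s + (r - p) ->
  Rabs (u p x - (f (x + p) + f (x - p)) / 2) <=
    Rabs H / 2 * F + Qm * A * exp (L * p) / (2 * L).
Proof.
intros A0 hA hp hx.
pose proof cone_Qm_nonneg as Qm0; pose proof cone_rate_ge1 as L1.
assert (I := duhamel_wave T k0 H Q Y Z l p x k0p cQ S hl ltac:(lra)).
assert (B1 : Rabs (RInt f (x - p) (x + p)) <= F).
{ eapply Rle_trans; [apply RInt_Rabs_le; [lra |] |].
  - apply ex_RInt_continuous_everywhere; intros; apply continuous_cosh_sum.
  - apply (RInt_le_subinterval (fun t => Rabs (f t))); try lra.
    + intros; apply continuous_Rabs_cosh_sum.
    + intros; apply Rabs_pos. }
assert (J : is_RInt (fun p' => Qm * A * exp (L * p')) 0 p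
              (Qm * A * exp (L * p) / L - Qm * A * exp (L * 0) / L)).
{ apply (RInt_of_derive_closed (fun t => Qm * A * exp (L * t) / L)); [lra | |].
  - intros t _; auto_derive; [trivial | field; lra].
  - intros t _; apply (ex_derive_continuous (fun p' => Qm * A * exp (L * p'))).
    auto_derive; trivial. }
assert (B3 : forall p', 0 <= p' <= p ->
  Rabs (Q p' * RInt (u p') (x - (p - p')) (x + (p - p'))) <= Qm * A * exp (L * p')).
{ intros p' hp'.
  rewrite Rabs_mult, Rmult_assoc.
  apply Rmult_le_compat; auto using Rabs_pos; [apply Qb; lra |].
  eapply Rle_trans; [apply RInt_Rabs_le; [lra |] |].
  - apply ex_RInt_continuous_everywhere; intros; apply continuous_cosh_sum.
  - eapply Rle_trans; [| apply hA; lra].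
    apply (RInt_le_subinterval (fun t => Rabs (u p' t))); try lra.
    + intros; apply continuous_Rabs_cosh_sum.
    + intros; apply Rabs_pos. }
assert (B2 := @norm_RInt_le R_NormedModule
  (fun p' => Q p' * RInt (u p') (x - (p - p')) (x + (p - p')))
  (fun p' => Qm * A * exp (L * p')) 0 p _ _ (proj1 hp) B3 I J).
unfold norm in B2; simpl in B2; unfold abs in B2; simpl in B2.
fold f in B2; fold (u p x) in B2.
assert (B4 : 0 <= Qm * A * exp (L * 0) / L).
{ pose proof (exp_pos (L * 0)).
  apply Rmult_le_pos; [repeat apply Rmult_le_pos; lra |].
  left; apply Rinv_0_lt_compat; lra. }
replace (Qm * A * exp (L * p) / (2 * L)) with (Qm * A * exp (L * p) / L / 2) by (field; lra).
assert (B5 : Rabs (H * RInt f (x - p) (x + p)) <= Rabs H * F).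
{ rewrite Rabs_mult; apply Rmult_le_compat_l; auto using Rabs_pos. }
apply Rabs_le_between in B2; apply Rabs_le_between in B5; apply Rabs_le_between; lra.
Qed.

Lemma cone_F_nonneg : 0 <= F.
Proof.
apply (RInt_nonneg (fun t => Rabs (f t))); [lra | |].
- intros; apply continuous_Rabs_cosh_sum.
- intros; apply Rabs_pos.
Qed.

(** Integration of [cone_pointwise] over a slice, whose width is at most [2 T], multiplies the
    source term by [T * Qm / L]; the rate makes this at most one half. *)
Lemma cone_step (A p : R) :
  0 <= A -> (forall p', 0 <= p' <= r -> N p' <= A * exp (L * p')) ->
  0 <= p <= r -> N p <= (F * (1 + T * Rabs H) + A / 2) * exp (L * p).
Proof.
intros A0 hA hp.
pose proof cone_Qm_nonneg as Qm0; pose proof cone_rate_ge1 as L1.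
pose proof cone_F_nonneg as F0; pose proof (Rabs_pos H) as H0.
set (D := Rabs H / 2 * F + Qm * A * exp (L * p) / (2 * L)).
assert (E1 : 1 <= exp (L * p)).
{ rewrite <- exp_0; destruct (Req_dec p 0) as [-> | np];
    [rewrite Rmult_0_r; lra | left; apply exp_increasing; nra]. }
assert (N1 : N p <= F + (s + (r - p) - (s - (r - p))) * D).
{ unfold F; replace (s - r) with (s - (r - p) - p) by ring.
  replace (s + r) with (s + (r - p) + p) by ring.
  apply RInt_Rabs_average_le; try lra; try (intros; apply continuous_cosh_sum).
  intros t ht; exact (cone_pointwise A p t A0 hA hp ht). }
assert (S3 : T * Qm / L <= / 2).
{ apply (Rmult_le_reg_r L); [lra |]; unfold Rdiv; rewrite Rmult_assoc, Rinv_l by lra.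
  unfold L, cone_rate; lra. }
assert (D0 : 0 <= D).
{ unfold D; apply Rplus_le_le_0_compat; [nra |].
  apply Rmult_le_pos; [repeat apply Rmult_le_pos; lra |].
  left; apply Rinv_0_lt_compat; lra. }
assert (S4 : 2 * T * D <= T * Rabs H * F + A / 2 * exp (L * p)).
{ unfold D.
  replace (2 * T * (Rabs H / 2 * F + Qm * A * exp (L * p) / (2 * L)))
    with (T * Rabs H * F + (T * Qm / L) * (A * exp (L * p))) by (field; lra).
  assert (0 <= A * exp (L * p)) by (apply Rmult_le_pos; lra).
  apply Rplus_le_compat_l; nra. }
assert (S5 : (s + (r - p) - (s - (r - p))) * D <= 2 * T * D)
  by (apply Rmult_le_compat_r; lra).
assert (S6 : 0 <= F * (1 + T * Rabs H)) by (apply Rmult_le_pos; nra).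
nra.
Qed.

Lemma cone_bound :
  Rabs (cosh_sum (wave l Y r) s - (cosh_sum l (s + r) + cosh_sum l (s - r)) / 2) <=
  (Rabs H / 2 + Qm * (1 + T * Rabs H) * exp (cone_rate T Qm * T)) *
    RInt (fun t => Rabs (cosh_sum l t)) (s - r) (s + r).
Proof.
pose proof cone_Qm_nonneg as Qm0; pose proof cone_rate_ge1 as L1.
pose proof cone_F_nonneg as F0; pose proof (Rabs_pos H) as H0.
set (B := F * (1 + T * Rabs H)).
assert (B0 : 0 <= B) by (apply Rmult_le_pos; nra).
assert (N0 : forall p, 0 <= p <= r -> 0 <= N p).
{ intros p hp; apply (RInt_nonneg (fun t => Rabs (u p t))); [lra | |].
  - intros; apply continuous_Rabs_cosh_sum.
  - intros; apply Rabs_pos. }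
assert (K : forall p A, N p * exp (- (L * p)) <= A <-> N p <= A * exp (L * p)).
{ intros p A; rewrite exp_Ropp; pose proof (exp_pos (L * p)) as e.
  split; intros h.
  - apply (Rmult_le_compat_r (exp (L * p))) in h; [| lra].
    rewrite Rmult_assoc, Rinv_l, Rmult_1_r in h; lra.
  - apply (Rmult_le_reg_r (exp (L * p))); auto.
    rewrite Rmult_assoc, Rinv_l, Rmult_1_r; lra. }
destruct (wave_bounded T k0 H Q Y Z l (s - r) (s + r)) as [M [M0 hM]]; auto; try lra.
assert (hN : forall p, 0 <= p <= r -> N p * exp (- (L * p)) <= 2 * B).
{ apply (bound_of_halving (fun p => N p * exp (- (L * p))) r (2 * r * M) B).
  - intros p hp.
    assert (N p <= RInt (fun _ => M) (s - (r - p)) (s + (r - p))).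
    { apply RInt_le_on; [lra | | apply ex_RInt_const |].
      - apply ex_RInt_continuous_everywhere; intros; apply continuous_Rabs_cosh_sum.
      - intros t ht; apply hM; lra. }
    rewrite RInt_const in H1; unfold scal in H1; simpl in H1; unfold mult in H1; simpl in H1.
    assert (exp (- (L * p)) <= 1).
    { rewrite <- exp_0; destruct (Req_dec p 0) as [-> | np];
        [rewrite Rmult_0_r, Ropp_0; lra | left; apply exp_increasing; nra]. }
    pose proof (exp_pos (- (L * p))); specialize (N0 p hp); nra.
  - intros A hA p hp.
    assert (A0 : 0 <= A).
    { eapply Rle_trans; [| apply (hA p hp)].
      apply Rmult_le_pos; [auto | left; apply exp_pos]. }
    apply K, cone_step; auto.
    intros p' hp'; apply K; auto. }
(* The pointwise bound at the apex itself, now that [2 * B] is a legitimate growth constant. *)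
assert (C := cone_pointwise (2 * B) r s ltac:(lra)
   (fun p hp => proj1 (K p (2 * B)) (hN p hp)) ltac:(lra) ltac:(lra)).
fold f F; fold (u r s).
eapply Rle_trans; [exact C |].
assert (E : exp (L * r) <= exp (L * T)).
{ destruct (Req_dec r T) as [-> | nr]; [lra | left; apply exp_increasing; nra]. }
assert (E' : Qm * (2 * B) * exp (L * r) / (2 * L) <= Qm * B * exp (L * T)).
{ pose proof (exp_pos (L * r)).
  assert (0 <= Qm * B) by (apply Rmult_le_pos; auto).
  replace (Qm * (2 * B) * exp (L * r) / (2 * L)) with (Qm * B * exp (L * r) * / L) by (field; lra).
  assert (/ L <= 1) by (rewrite <- Rinv_1; apply Rinv_le_contravar; lra).
  assert (0 < / L) by (apply Rinv_0_lt_compat; lra).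
  apply Rle_trans with (Qm * B * exp (L * r)).
  - assert (0 <= Qm * B * exp (L * r)) by (apply Rmult_le_pos; lra); nra.
  - apply Rmult_le_compat_l; auto. }
apply Rle_trans with (Rabs H / 2 * F + Qm * B * exp (L * T)); [lra |].
right; unfold B, L; ring.
Qed.
End Cone.

Lemma RInt_Rabs_even (f : R -> R) (x : R) :
  0 <= x -> (forall t, continuous f t) -> (forall t, f (- t) = f t) ->
  RInt (fun t => Rabs (f t)) (- x) x = 2 * RInt (fun t => Rabs (f t)) 0 x.
Proof.
intros x0 cf ev.
assert (ex : forall u v, ex_RInt (fun t => Rabs (f t)) u v)
  by (intros; apply ex_RInt_continuous_everywhere; intros; apply continuous_Rabs_comp; auto).
rewrite <- (RInt_Chasles (V := R_CompleteNormedModule) _ (- x) 0 x) by auto.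
assert (E : RInt (fun t => Rabs (f t)) (- x) 0 = RInt (fun t => Rabs (f t)) 0 x).
{ rewrite <- (opp_RInt_swap (V := R_CompleteNormedModule)) by auto.
  assert (R1 := is_RInt_comp_opp (V := R_NormedModule) (fun t => Rabs (f t)) 0 x (RInt (fun t => Rabs (f t)) 0 (- x))).
  rewrite Ropp_0 in R1.
  specialize (R1 (RInt_correct (V := R_CompleteNormedModule) _ _ _ (ex 0 (- x)))).
  apply (is_RInt_opp (V := R_NormedModule)) in R1.
  symmetry; apply is_RInt_unique.
  apply (is_RInt_ext (V := R_NormedModule)) with (2 := R1).
  intros t _; unfold opp; simpl; rewrite Ropp_involutive, ev; auto. }
rewrite E; unfold plus; simpl; ring.
Qed.

(** The order of the quantifiers matters: [C] is fixed before the list, hence survives approximation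
    by longer and longer sums. *)
Lemma cone_bound_uniform (T H : R) (Q : R -> R) :
  0 <= T -> (forall t, continuous Q t) ->
  exists C, 0 <= C /\ forall (k0 : R) (Y Z : R -> R -> R) (l : list (R * R)) (r s : R),
    0 < k0 -> sol_family T k0 H Q Y Z -> freq_ge k0 l -> 0 <= r <= T ->
    Rabs (cosh_sum (wave l Y r) s - (cosh_sum l (s + r) + cosh_sum l (s - r)) / 2) <=
    C * RInt (fun t => Rabs (cosh_sum l t)) (s - r) (s + r).
Proof.
intros T0 cQ.
destruct (continuous_bounded Q 0 T T0) as [Qm [Qm0 hQm]]; [auto |].
exists (Rabs H / 2 + Qm * (1 + T * Rabs H) * exp (cone_rate T Qm * T)); split.
- pose proof (Rabs_pos H); pose proof (exp_pos (cone_rate T Qm * T)).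
  assert (0 <= Qm * (1 + T * Rabs H) * exp (cone_rate T Qm * T))
    by (repeat apply Rmult_le_pos; nra); lra.
- intros; apply (cone_bound T k0 H Qm Q Y Z); auto.
Qed.

(** The wave [w] of the first problem at time [r] is the initial data of the second. At [s = 0]
    every [cosh (k s)] is 1, which leaves the sum of products; by evenness the mean of [w (r)] and
    [w (- r)] is [w (r)], to which the first estimate applies again. *)
Lemma product_bound (T H Ht : R) (Q Qt : R -> R) :
  0 <= T -> (forall t, continuous Q t) -> (forall t, continuous Qt t) ->
  exists K, 0 <= K /\ forall (k0 : R) (Y Z Yt Zt : R -> R -> R) (l : list (R * R)) (r : R),
    0 < k0 -> sol_family T k0 H Q Y Z -> sol_family T k0 Ht Qt Yt Zt ->
    freq_ge k0 l -> 0 <= r <= T ->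
    Rabs (lsum l (fun k => Y k r * Yt k r) - (cosh_sum l (2 * r) + cosh_sum l 0) / 2) <=
    K * RInt (fun t => Rabs (cosh_sum l t)) 0 (2 * r).
Proof.
intros T0 cQ cQt.
destruct (cone_bound_uniform T H Q T0 cQ) as [C [C0 hC]].
destruct (cone_bound_uniform T Ht Qt T0 cQt) as [D [D0 hD]].
(* [D] times the norm of [w], itself at most [(1 + 2 T C) F], plus [C F] for the value [w (r)]; the
   outer 2 passes from [[- 2 r, 2 r]] to [[0, 2 r]] by evenness. *)
exists (2 * (D * (1 + 2 * T * C) + C)); split.
{ assert (0 <= T * C) by (apply Rmult_le_pos; auto).
  assert (0 <= D * (1 + 2 * T * C)) by (apply Rmult_le_pos; lra); lra. }
intros k0 Y Z Yt Zt l r k0p S St hl hr.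
set (f := cosh_sum l).
set (F := RInt (fun t => Rabs (f t)) (- (2 * r)) (2 * r)).
assert (cf : forall t, continuous f t) by (intros; apply continuous_cosh_sum).
assert (EF : F = 2 * RInt (fun t => Rabs (f t)) 0 (2 * r)).
{ apply RInt_Rabs_even; auto; [lra | intros; apply cosh_sum_opp]. }
assert (F0 : 0 <= F).
{ apply RInt_nonneg; [lra | intros; apply continuous_Rabs_comp; auto | intros; apply Rabs_pos]. }
set (w := wave l Y r).
assert (hw : freq_ge k0 w) by (apply freq_ge_wave; auto).
assert (A1 := hD k0 Yt Zt w r 0 k0p St hw hr).
replace (0 + r) with r in A1 by ring; replace (0 - r) with (- r) in A1 by ring.
rewrite (cosh_sum_opp w) in A1.
assert (E1 : cosh_sum (wave w Yt r) 0 = lsum l (fun k => Y k r * Yt k r)).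
{ rewrite cosh_sum_wave; unfold w, wave.
  rewrite (lsum_reweight l (fun k => Y k r)).
  apply (lsum_ext k0); auto; intros k _; rewrite Rmult_0_r, cosh_0; ring. }
rewrite E1 in A1.
assert (P : forall s, - r <= s <= r -> Rabs (cosh_sum w s - (f (s + r) + f (s - r)) / 2) <= C * F).
{ intros s hs; eapply Rle_trans; [apply (hC k0 Y Z l r s); auto |].
  apply Rmult_le_compat_l; auto.
  apply RInt_le_subinterval; try lra;
    [intros; apply continuous_Rabs_comp; auto | intros; apply Rabs_pos]. }
assert (A2 := P r ltac:(lra)).
replace (r - r) with 0 in A2 by ring; replace (r + r) with (2 * r) in A2 by ring.
assert (G : RInt (fun t => Rabs (cosh_sum w t)) (- r) r <= F + 2 * T * C * F).
{ assert (N1 : RInt (fun t => Rabs (cosh_sum w t)) (- r) r <= F + (r - - r) * (C * F)).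
  { unfold F at 1; replace (- (2 * r)) with (- r - r) by ring.
    replace (2 * r) with (r + r) by ring.
    apply RInt_Rabs_average_le; auto; try lra; intros; apply continuous_cosh_sum. }
  assert (0 <= C * F) by (apply Rmult_le_pos; auto).
  nra. }
assert (A3 : D * RInt (fun t => Rabs (cosh_sum w t)) (- r) r <= D * (F + 2 * T * C * F))
  by (apply Rmult_le_compat_l; auto).
replace (2 * (D * (1 + 2 * T * C) + C) * RInt (fun t => Rabs (f t)) 0 (2 * r))
  with (D * (F + 2 * T * C * F) + C * F) by (rewrite EF; ring).
apply Rabs_le_between in A1; apply Rabs_le_between in A2; apply Rabs_le_between; lra.
Qed.

(** * Density of the hyperbolic cosines *)

(* The expectation of [psi] under the binomial law with parameters [n] and [y],
   that is, Bernstein's operator when [psi k = phi (k / n)]. *)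
Fixpoint binomial_mean (n : nat) (psi : nat -> R) (y : R) : R :=
  match n with
  | O => psi O
  | S m => y * binomial_mean m (fun k => psi (S k)) y + (1 - y) * binomial_mean m psi y
  end.

Lemma binomial_mean_le (n : nat) (psi1 psi2 : nat -> R) (y : R) :
  0 <= y <= 1 -> (forall k, (k <= n)%nat -> psi1 k <= psi2 k) ->
  binomial_mean n psi1 y <= binomial_mean n psi2 y.
Proof.
intros hy; revert psi1 psi2; induction n as [|n IH]; simpl; intros psi1 psi2 h.
- apply h; auto.
- apply Rplus_le_compat; (apply Rmult_le_compat_l; [lra |]); apply IH; intros k hk; apply h; lia.
Qed.

Lemma binomial_mean_ext (n : nat) (psi1 psi2 : nat -> R) (y : R) :
  (forall k, psi1 k = psi2 k) -> binomial_mean n psi1 y = binomial_mean n psi2 y.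
Proof.
revert psi1 psi2; induction n as [|n IH]; simpl; intros psi1 psi2 h; auto.
rewrite (IH (fun k => psi1 (S k)) (fun k => psi2 (S k))), (IH psi1 psi2); auto.
Qed.

(** Mean and variance of the binomial law at once. The shift [c] lets the induction close: a success
    replaces [c] by [c + 1]. *)
Lemma binomial_mean_quadratic (n : nat) (a b c y : R) :
  binomial_mean n (fun k => a + b * (INR k + c) ^ 2) y =
  a + b * ((INR n * y + c) ^ 2 + INR n * y * (1 - y)).
Proof.
revert c; induction n as [|n IH]; intros c.
- simpl; ring.
- cbn [binomial_mean]; rewrite IH.
  rewrite (binomial_mean_ext n _ (fun k => a + b * (INR k + (c + 1)) ^ 2)).
  + rewrite IH, S_INR; ring.
  + intros k; rewrite S_INR; ring.
Qed.

(** Chebyshev's argument: [phi (k / n)] lies within [eta / 2 + B (k / n - y) ^ 2] of [phi y], by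
    uniform continuity near [y] and by boundedness away from it. The mean of these parabolas is
    explicit, and its quadratic part is of order [1 / n]. *)
Lemma bernstein (phi : R -> R) (eta : R) :
  (forall t, continuous phi t) -> 0 < eta ->
  exists n, forall y, 0 <= y <= 1 ->
    Rabs (binomial_mean n (fun k => phi (INR k / INR n)) y - phi y) <= eta.
Proof.
intros cphi eta0.
destruct (continuous_bounded phi 0 1) as [M [M0 hM]]; [lra | auto |].
destruct (fun c => @Heine_cor2 phi 0 1 c (mkposreal (eta / 2) ltac:(lra))) as [d hd].
{ intros x _; apply continuity_pt_filterlim; apply cphi. }
simpl in hd; pose proof (cond_pos d) as d0.
set (B := 2 * M / d ^ 2).
assert (d2 : 0 < d ^ 2) by (apply pow_lt; auto).
assert (B0 : 0 <= B) by (apply Rmult_le_pos; [lra | left; apply Rinv_0_lt_compat; auto]).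
destruct (archimed_cor1 (eta / 2 / (B + 1))) as [n [hn n0]].
{ apply Rdiv_lt_0_compat; lra. }
exists n; intros y hy.
assert (n1 : 0 < INR n) by (apply lt_0_INR; auto).
assert (P : forall k, (k <= n)%nat ->
  Rabs (phi (INR k / INR n) - phi y) <= eta / 2 + B / INR n ^ 2 * (INR k + - (INR n * y)) ^ 2).
{ intros k hk.
  assert (hk1 : 0 <= INR k / INR n <= 1).
  { pose proof (pos_INR k); apply le_INR in hk; split.
    - apply Rmult_le_pos; [lra | left; apply Rinv_0_lt_compat; auto].
    - apply (Rmult_le_reg_r (INR n)); auto; unfold Rdiv; rewrite Rmult_assoc, Rinv_l; lra. }
  assert (sq : B / INR n ^ 2 * (INR k + - (INR n * y)) ^ 2 = B * (INR k / INR n - y) ^ 2)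
    by (field; lra).
  rewrite sq.
  destruct (Rlt_or_le (Rabs (INR k / INR n - y)) d) as [near | far].
  - specialize (hd (INR k / INR n) y hk1 hy near).
    assert (0 <= B * (INR k / INR n - y) ^ 2) by (apply Rmult_le_pos; auto; apply pow2_ge_0).
    lra.
  - assert (Rabs (phi (INR k / INR n) - phi y) <= 2 * M).
    { pose proof (hM _ hk1) as h1; pose proof (hM _ hy) as h2.
      apply Rabs_le_between in h1; apply Rabs_le_between in h2; apply Rabs_le_between; lra. }
    assert (d ^ 2 <= (INR k / INR n - y) ^ 2).
    { rewrite <- (pow2_abs (INR k / INR n - y)); apply pow_incr; lra. }
    assert (2 * M = B * d ^ 2) by (unfold B; field; lra).
    assert (B * d ^ 2 <= B * (INR k / INR n - y) ^ 2) by (apply Rmult_le_compat_l; auto).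
    lra. }
assert (E : B / INR n ^ 2 * ((INR n * y + - (INR n * y)) ^ 2 + INR n * y * (1 - y)) <= eta / 2).
{ replace (B / INR n ^ 2 * ((INR n * y + - (INR n * y)) ^ 2 + INR n * y * (1 - y)))
    with (B * (y * (1 - y)) * / INR n) by (field; lra).
  assert (0 < / INR n) by (apply Rinv_0_lt_compat; auto).
  assert (y * (1 - y) <= 1) by nra.
  assert (0 <= y * (1 - y)) by nra.
  assert ((B + 1) * (eta / 2 / (B + 1)) = eta / 2) by (field; lra).
  assert (B * (y * (1 - y)) <= B + 1) by nra.
  nra. }
assert (U : binomial_mean n (fun k => phi (INR k / INR n)) y <=
  phi y + eta / 2 + B / INR n ^ 2 * ((INR n * y + - (INR n * y)) ^ 2 + INR n * y * (1 - y))).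
{ rewrite <- binomial_mean_quadratic; apply binomial_mean_le; auto.
  intros k hk; specialize (P k hk); apply Rabs_le_between in P; lra. }
assert (L : phi y - eta / 2 + - (B / INR n ^ 2) * ((INR n * y + - (INR n * y)) ^ 2 + INR n * y * (1 - y)) <=
  binomial_mean n (fun k => phi (INR k / INR n)) y).
{ rewrite <- binomial_mean_quadratic; apply binomial_mean_le; auto.
  intros k hk; specialize (P k hk); apply Rabs_le_between in P; lra. }
apply Rabs_le_between; lra.
Qed.

(** Polynomials in [sinh ^ 2] alone would produce the frequency 0, below the threshold. A factor
    [cosh (kap s)] makes all frequencies odd multiples of [kap], hence at least [kap]. *)
Definition odd_freq (kap : R) (l : list (R * R)) : Prop :=
  forall p, In p l -> exists j, snd p = (2 * INR j + 1) * kap.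

Lemma cosh_sum_app (l1 l2 : list (R * R)) (s : R) :
  cosh_sum (l1 ++ l2) s = cosh_sum l1 s + cosh_sum l2 s.
Proof. unfold cosh_sum; induction l1 as [|p l1 IH]; simpl; [ring | rewrite IH; ring]. Qed.

Lemma odd_freq_mul_sinh_sqr (kap : R) (l : list (R * R)) :
  0 < kap -> odd_freq kap l ->
  exists l', odd_freq kap l' /\
    forall s, cosh_sum l' s = sinh (kap * s) ^ 2 * cosh_sum l s.
Proof.
intros kp; induction l as [|[c k] l IH]; intros hl.
- exists nil; split; [intros p [] | intros s; unfold cosh_sum; simpl; ring].
- destruct IH as [l' [hl' E]]; [intros p hp; apply hl; simpl; auto |].
  destruct (hl (c, k)) as [j ej]; [simpl; auto |]; simpl in ej.
  (* Product formula for [sinh ^ 2] times [cosh]. The absolute value matters only for [k = kap],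
     where [k - 2 * kap] is negative. *)
  exists ((c / 4, k + 2 * kap) :: (c / 4, Rabs (k - 2 * kap)) :: (- c / 2, k) :: l'); split.
  + intros p [<- | [<- | [<- | hp]]]; simpl; auto.
    * exists (S j); rewrite S_INR, ej; ring.
    * destruct j as [|j].
      -- exists O; simpl in *; replace (k - 2 * kap) with (- kap) by (rewrite ej; ring).
         rewrite Rabs_Ropp, Rabs_pos_eq; lra.
      -- exists j; rewrite S_INR in ej; pose proof (pos_INR j).
         replace (k - 2 * kap) with ((2 * INR j + 1) * kap) by (rewrite ej; ring).
         rewrite Rabs_pos_eq; auto; nra.
    * exists j; auto.
  + intros s; unfold cosh_sum in *; simpl; rewrite E.
    assert (EA : cosh (Rabs (k - 2 * kap) * s) = cosh ((k - 2 * kap) * s)).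
    { unfold Rabs; destruct Rcase_abs; auto.
      replace (- (k - 2 * kap) * s) with (- ((k - 2 * kap) * s)) by ring; apply cosh_opp. }
    rewrite EA.
    replace ((k - 2 * kap) * s) with (k * s + - (kap * s + kap * s)) by ring.
    replace ((k + 2 * kap) * s) with (k * s + (kap * s + kap * s)) by ring.
    rewrite !cosh_plus, !sinh_opp, !cosh_opp, !cosh_plus, !sinh_plus.
    assert (C2 : cosh (kap * s) ^ 2 = 1 + sinh (kap * s) ^ 2).
    { unfold cosh, sinh; rewrite exp_Ropp; field.
      apply Rgt_not_eq, exp_pos. }
    set (cc := cosh (kap * s)) in *; set (ss := sinh (kap * s)) in *.
    replace (cc * cc) with (1 + ss ^ 2) by (rewrite <- C2; ring).
    field.
Qed.

Lemma odd_freq_binomial_mean (kap S0 : R) (n : nat) (psi : nat -> R) :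
  0 < kap ->
  exists l, odd_freq kap l /\ forall s,
    cosh_sum l s = cosh (kap * s) * binomial_mean n psi (sinh (kap * s) ^ 2 / S0).
Proof.
intros kp; revert psi; induction n as [|n IH]; intros psi.
- exists ((psi O, kap) :: nil); split.
  + intros p [<- | []]; exists O; simpl; ring.
  + intros s; unfold cosh_sum; simpl; ring.
- destruct (IH (fun k => psi (S k))) as [l1 [h1 E1]], (IH psi) as [l2 [h2 E2]].
  assert (hw : forall c l, odd_freq kap l -> odd_freq kap (map (fun p => (fst p * c, snd p)) l)).
  { intros c l hl p hp; apply in_map_iff in hp; destruct hp as [x [<- hx]]; apply (hl x hx). }
  assert (Ew : forall c l s, cosh_sum (map (fun p => (fst p * c, snd p)) l) s = c * cosh_sum l s).
  { intros c l s; unfold cosh_sum; rewrite (lsum_reweight l (fun _ => c)); apply lsum_scal. }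
  (* Since [y A + (1 - y) B = y (A - B) + B], one multiplication by [sinh ^ 2] is enough; [l3]
     represents [(A - B) / S0]. *)
  set (l3 := map (fun p => (fst p * / S0, snd p)) l1
          ++ map (fun p => (fst p * - / S0, snd p)) l2).
  destruct (odd_freq_mul_sinh_sqr kap l3) as [l4 [h4 E4]]; auto.
  { intros p hp; apply in_app_iff in hp; destruct hp as [hp | hp]; revert p hp; apply hw; auto. }
  exists (l4 ++ l2); split.
  + intros p hp; apply in_app_iff in hp; destruct hp as [hp | hp]; auto.
  + intros s; rewrite cosh_sum_app, E4; unfold l3; rewrite cosh_sum_app, !Ew, E1, E2; simpl.
    unfold Rdiv; ring.
Qed.

Lemma continuous_arcsinh (x : R) : continuous arcsinh x.
Proof.
apply (ex_derive_continuous arcsinh); eexists.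
apply is_derive_Reals, derivable_pt_lim_arcsinh.
Qed.

(* On [0, R0] the variable [y = sinh^2 (k0 s)] is a homeomorphic change of parameter, and
   [cosh (k0 s) y^j] is a combination of the [cosh ((2 i + 1) k0 s)]. *)
Lemma cosh_sum_dense (k0 R0 eta : R) (g : R -> R) :
  0 < k0 -> 0 < R0 -> 0 < eta -> (forall t, continuous g t) ->
  exists l, freq_ge k0 l /\
    forall s, 0 <= s <= R0 -> Rabs (cosh_sum l s - g s) <= eta.
Proof.
intros kp R0p ep cg.
set (S0 := sinh (k0 * R0) ^ 2).
assert (sm : forall x y, x <= y -> sinh x <= sinh y).
{ intros x y [h | ->]; [left; apply sinh_lt; auto | lra]. }
assert (S0p : 0 < S0).
{ apply pow_lt; rewrite <- sinh_0; apply sinh_lt; nra. }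
assert (cosh_pos : forall x, 0 < cosh x).
{ intros x; unfold cosh; pose proof (exp_pos x); pose proof (exp_pos (- x)); lra. }
(* Inverse of the parameter change [s] to [y] on [[0, 1]]; as [sqrt] is 0 on negative numbers, it is
   continuous on the whole line. *)
set (sg := fun y => arcsinh (sqrt (S0 * y)) / k0).
assert (csg : forall y, continuous sg y).
{ intros y; apply (continuous_mult (fun y => arcsinh (sqrt (S0 * y))) (fun _ => / k0));
    [| apply continuous_const].
  apply (continuous_comp (fun y => sqrt (S0 * y)) arcsinh); [| apply continuous_arcsinh].
  apply (continuous_comp (fun y => S0 * y) sqrt); [| apply continuous_sqrt].
  apply (continuous_mult (fun _ => S0)); [apply continuous_const | apply continuous_id]. }
(* The factor [cosh (k0 s)] carried by all available sums is divided out of [g] beforehand;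
   multiplying back costs at most [M], hence the accuracy [eta / M]. *)
set (phi := fun y => g (sg y) * / cosh (k0 * sg y)).
assert (cphi : forall y, continuous phi y).
{ intros y; apply (continuous_mult (fun y => g (sg y)) (fun y => / cosh (k0 * sg y))).
  - apply (continuous_comp sg g); auto.
  - apply (continuous_comp (fun y => cosh (k0 * sg y)) Rinv).
    + apply (continuous_comp sg (fun s => cosh (k0 * s))); auto; apply continuous_cosh_scal.
    + apply continuous_Rinv, Rgt_not_eq, cosh_pos. }
set (M := cosh (k0 * R0)).
destruct (bernstein phi (eta / M)) as [n hn]; auto.
{ apply Rdiv_lt_0_compat; auto; apply cosh_pos. }
destruct (odd_freq_binomial_mean k0 S0 n (fun k => phi (INR k / INR n)) kp) as [l [hl E]].
exists l; split.
{ intros p hp; destruct (hl p hp) as [j ->]; pose proof (pos_INR j); nra. }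
intros s hs; rewrite E.
assert (s0 : 0 <= sinh (k0 * s)) by (rewrite <- sinh_0; apply sm; nra).
assert (s1 : sinh (k0 * s) <= sinh (k0 * R0)) by (apply sm; nra).
set (y := sinh (k0 * s) ^ 2 / S0).
assert (hy : 0 <= y <= 1).
{ unfold y; split.
  - apply Rmult_le_pos; [apply pow2_ge_0 | left; apply Rinv_0_lt_compat; auto].
  - apply (Rmult_le_reg_r S0); auto; unfold Rdiv; rewrite Rmult_assoc, Rinv_l by lra.
    rewrite Rmult_1_r, Rmult_1_l; apply pow_incr; auto. }
assert (Esg : sg y = s).
{ unfold sg, y; replace (S0 * (sinh (k0 * s) ^ 2 / S0)) with (sinh (k0 * s) ^ 2) by (field; lra).
  rewrite sqrt_pow2, arcsinh_sinh by auto; field; lra. }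
specialize (hn y hy).
set (b := binomial_mean n _ y) in *.
assert (Eg : g s = cosh (k0 * s) * phi y).
{ unfold phi; rewrite Esg; field; apply Rgt_not_eq, cosh_pos. }
rewrite Eg, <- Rmult_minus_distr_l, Rabs_mult, (Rabs_pos_eq (cosh _)) by (left; auto).
assert (Mle : cosh (k0 * s) <= M).
{ apply (nondecreasing_of_derive (fun t => cosh (k0 * t)) (fun t => k0 * sinh (k0 * t))); [lra | |].
  - intros; apply is_derive_cosh_scal.
  - intros t ht; apply Rmult_le_pos; [lra |]; rewrite <- sinh_0; apply sm; nra. }
replace eta with (M * (eta / M)) by (field; apply Rgt_not_eq, cosh_pos).
apply Rmult_le_compat; auto using Rabs_pos; left; auto.
Qed.

(** * The key inequality and its consequences *)

(** In the derivative of [Yt Z - Y Zt] the terms with [k ^ 2] cancel. The last hypothesis is the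
    equality of the Weyl functions with denominators cleared. *)
Lemma wronskian_RInt (T k H Ht h ht : R) (Q Qt Y Z Yt Zt : R -> R) :
  0 <= T -> (forall t, continuous Q t) -> (forall t, continuous Qt t) ->
  ode_sol T k Q Y Z -> ode_sol T k Qt Yt Zt ->
  Y 0 = 1 -> Z 0 = H -> Yt 0 = 1 -> Zt 0 = Ht ->
  Y T * (ht * Yt T + Zt T) = Yt T * (h * Y T + Z T) ->
  is_RInt (fun r => (Q r - Qt r) * (Y r * Yt r)) 0 T
    (Ht - H + (ht - h) * (Y T * Yt T)).
Proof.
intros T0 cQ cQt S St Y0 Z0 Yt0 Zt0 E.
replace (Ht - H + (ht - h) * (Y T * Yt T))
  with ((Yt T * Z T - Y T * Zt T) - (Yt 0 * Z 0 - Y 0 * Zt 0))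
  by (rewrite Y0, Z0, Yt0, Zt0; lra).
apply (RInt_of_derive_closed (fun r => Yt r * Z r - Y r * Zt r)); auto.
- intros r hr; destruct (S r hr) as [DY DZ], (St r hr) as [DYt DZt].
  auto_derive.
  + repeat split; eexists; eauto.
  + change (fun x => Y x) with Y; change (fun x => Z x) with Z.
    change (fun x => Yt x) with Yt; change (fun x => Zt x) with Zt.
    rewrite (is_derive_unique _ _ _ DY), (is_derive_unique _ _ _ DYt),
      (is_derive_unique _ _ _ DZ), (is_derive_unique _ _ _ DZt); ring.
- intros r hr.
  destruct (ode_sol_continuous _ _ _ _ _ r S hr), (ode_sol_continuous _ _ _ _ _ r St hr).
  apply (continuous_mult (fun r => Q r - Qt r)).
  + apply (continuous_minus (V := R_NormedModule) Q Qt); auto.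
  + apply (continuous_mult Y); auto.
Qed.

Lemma Rle_of_le_plus_small (x y c : R) :
  0 <= c -> (forall eta, 0 < eta -> x <= y + c * eta) -> x <= y.
Proof.
intros c0 h; apply le_epsilon; intros e e0.
specialize (h (e / (c + 1)) ltac:(apply Rdiv_lt_0_compat; lra)).
assert ((c + 1) * (e / (c + 1)) = e) by (field; lra).
assert (0 < e / (c + 1)) by (apply Rdiv_lt_0_compat; lra).
nra.
Qed.

Lemma continuous_RInt_double (g : R -> R) (t : R) :
  (forall x, continuous g x) -> continuous (fun r => RInt g 0 (2 * r)) t.
Proof.
intros cg; apply (continuous_comp (fun r => 2 * r) (fun x => RInt g 0 x)).
- apply (continuous_mult (fun _ => 2)); [apply continuous_const | apply continuous_id].
- apply (ex_derive_continuous (fun x => RInt g 0 x)); eexists.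
  apply (is_derive_RInt g (fun x => RInt g 0 x) 0); [| auto].
  exists (mkposreal 1 Rlt_0_1); intros y _.
  apply (RInt_correct (V := R_CompleteNormedModule)), ex_RInt_continuous_everywhere; auto.
Qed.

Lemma continuous_comp_double (g : R -> R) (t : R) :
  (forall x, continuous g x) -> continuous (fun r => g (2 * r)) t.
Proof.
intros cg; apply (continuous_comp (fun r => 2 * r) g); auto.
apply (continuous_mult (fun _ => 2)); [apply continuous_const | apply continuous_id].
Qed.

(** * From sums of hyperbolic cosines to arbitrary continuous functions *)

Section Uniqueness.
Variables (T k0 H Ht h ht : R) (Q Qt : R -> R) (Y Z Yt Zt : R -> R -> R).
Hypotheses (T0 : 0 < T) (k0p : 0 < k0)
  (cQ : forall t, continuous Q t) (cQt : forall t, continuous Qt t)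
  (Sol : sol_family T k0 H Q Y Z) (Solt : sol_family T k0 Ht Qt Yt Zt)
  (same_weyl : forall k, k0 <= k ->
     Y k T * (ht * Yt k T + Zt k T) = Yt k T * (h * Y k T + Z k T)).

Let V (r : R) : R := Q r - Qt r.
Let P (l : list (R * R)) (r : R) : R := lsum l (fun k => Y k r * Yt k r).

Lemma diff_continuous (t : R) : continuous V t.
Proof. apply (continuous_minus (V := R_NormedModule) Q Qt); auto. Qed.

Lemma wronskian_lsum (l : list (R * R)) :
  freq_ge k0 l ->
  is_RInt (fun r => V r * P l r) 0 T ((Ht - H) * cosh_sum l 0 + (ht - h) * P l T).
Proof.
intros hl; unfold P, cosh_sum.
rewrite <- !lsum_scal, <- lsum_plus.
apply (is_RInt_ext (V := R_NormedModule)) with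
  (f := fun r => lsum l (fun k => V r * (Y k r * Yt k r))).
{ intros r _; apply lsum_scal. }
apply (is_RInt_lsum k0 l (fun k r => V r * (Y k r * Yt k r))); auto.
intros k hk; rewrite Rmult_0_r, cosh_0, Rmult_1_r.
destruct (Sol k hk) as [S1 [S2 S3]], (Solt k hk) as [S4 [S5 S6]].
apply (wronskian_RInt T k H Ht h ht Q Qt (Y k) (Z k) (Yt k) (Zt k)); auto; lra.
Qed.

Lemma key_inequality :
  exists K, 0 <= K /\ forall g : R -> R, (forall t, continuous g t) ->
  Rabs (RInt (fun r => V r * ((g (2 * r) + g 0) / 2)) 0 T
        - (Ht - H) * g 0 - (ht - h) * ((g (2 * T) + g 0) / 2)) <=
  RInt (fun r => Rabs (V r) * (K * RInt (fun t => Rabs (g t)) 0 (2 * r))) 0 T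
  + Rabs (ht - h) * (K * RInt (fun t => Rabs (g t)) 0 (2 * T)).
Proof.
destruct (product_bound T H Ht Q Qt) as [K [K0 hK]]; auto; [lra |].
destruct (continuous_bounded V 0 T) as [Vm [Vm0 hVm]]; [lra | intros; apply diff_continuous |].
exists K; split; auto; intros g cg.
assert (cag : forall t, continuous (fun x => Rabs (g x)) t)
  by (intros; apply continuous_Rabs_comp; auto).
assert (T2K : 0 <= T * K) by (apply Rmult_le_pos; lra).
pose proof (Rabs_pos (Ht - H)) as aH; pose proof (Rabs_pos (ht - h)) as ah.
(* Cost of a uniform error [eta] in the data: [(2 T K + 1) eta] for each sum of products, through
   the [L^1] norm and the mean of two values, and [eta] for the value at 0. *)
apply Rle_of_le_plus_small with
  (c := T * Vm * (2 * T * K + 1) + Rabs (Ht - H) + Rabs (ht - h) * (2 * T * K + 1)).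
{ assert (0 <= T * Vm * (2 * T * K + 1)) by (repeat apply Rmult_le_pos; lra).
  assert (0 <= Rabs (ht - h) * (2 * T * K + 1)) by (apply Rmult_le_pos; lra). lra. }
intros eta eta0.
destruct (cosh_sum_dense k0 (2 * T) eta g) as [l [hl app]]; auto; [lra |].
assert (B : forall r, 0 <= r <= T ->
  Rabs (P l r - (g (2 * r) + g 0) / 2) <=
    K * RInt (fun t => Rabs (g t)) 0 (2 * r) + (2 * T * K + 1) * eta).
{ intros r hr.
  assert (B1 := hK k0 Y Z Yt Zt l r k0p Sol Solt hl hr); fold (P l r) in B1.
  assert (B2 : RInt (fun t => Rabs (cosh_sum l t)) 0 (2 * r) <=
               RInt (fun t => Rabs (g t)) 0 (2 * r) + 2 * r * eta).
  { assert (B3 : RInt (fun t => Rabs (cosh_sum l t)) 0 (2 * r) <=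
                 RInt (fun t => Rabs (g t) + eta) 0 (2 * r)).
    { apply RInt_le_on; [lra | | |].
      - apply ex_RInt_continuous_everywhere; intros; apply continuous_Rabs_cosh_sum.
      - apply (ex_RInt_plus (V := R_NormedModule));
          [apply ex_RInt_continuous_everywhere; auto | apply ex_RInt_const].
      - intros t ht'; specialize (app t ltac:(lra)).
        apply Rabs_le_between in app.
        pose proof (proj1 (Rabs_le_between (g t) _) (Rle_refl _)).
        apply Rabs_le_between; lra. }
    rewrite (RInt_plus (V := R_CompleteNormedModule) _ (fun _ => eta)), RInt_const in B3
      by (apply ex_RInt_const || (apply ex_RInt_continuous_everywhere; auto)).
    unfold plus, scal in B3; simpl in B3; unfold mult in B3; simpl in B3; lra. }
  assert (B4 := app (2 * r) ltac:(lra)); assert (B5 := app 0 ltac:(lra)).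
  apply Rabs_le_between in B4; apply Rabs_le_between in B5; apply Rabs_le_between in B1.
  assert (B6 : K * RInt (fun t => Rabs (cosh_sum l t)) 0 (2 * r) <=
     K * (RInt (fun t => Rabs (g t)) 0 (2 * r) + 2 * r * eta))
    by (apply Rmult_le_compat_l; auto).
  assert (K * (r * eta) <= K * (T * eta)) by (apply Rmult_le_compat_l; nra).
  apply Rabs_le_between; lra. }
assert (cI : forall r, continuous (fun r => V r * ((g (2 * r) + g 0) / 2)) r).
{ intros r; apply (continuous_mult V); [apply diff_continuous |].
  apply (continuous_mult (fun r => g (2 * r) + g 0) (fun _ => / 2)); [| apply continuous_const].
  apply (continuous_plus (V := R_NormedModule) (fun r => g (2 * r)));
    [apply continuous_comp_double; auto | apply continuous_const]. }
assert (W1 := wronskian_lsum l hl).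
assert (W2 := RInt_correct (V := R_CompleteNormedModule) _ 0 T
   (ex_RInt_continuous_everywhere _ 0 T cI)).
set (I := RInt (fun r => V r * ((g (2 * r) + g 0) / 2)) 0 T) in *.
assert (W3 := is_RInt_minus (V := R_NormedModule) _ _ _ _ _ _ W1 W2).
assert (cM : forall r, continuous (fun r => Rabs (V r) * (K * RInt (fun t => Rabs (g t)) 0 (2 * r))) r).
{ intros r; apply (continuous_mult (fun r => Rabs (V r))).
  - apply continuous_Rabs_comp, diff_continuous.
  - apply (continuous_mult (fun _ => K)); [apply continuous_const |].
    apply continuous_RInt_double; auto. }
assert (W4 := RInt_correct (V := R_CompleteNormedModule) _ 0 T
   (ex_RInt_continuous_everywhere _ 0 T cM)).
set (J := RInt _ 0 T) in W4.
assert (W5 := is_RInt_plus (V := R_NormedModule) _ _ _ _ _ _ W4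
   (is_RInt_const (V := R_NormedModule) 0 T (Vm * ((2 * T * K + 1) * eta)))).
assert (W6 := fun hle => @norm_RInt_le R_NormedModule _ _ 0 T _ _ (Rlt_le _ _ T0) hle W3 W5).
assert (W7 : Rabs ((Ht - H) * cosh_sum l 0 + (ht - h) * P l T - I) <=
   J + T * (Vm * ((2 * T * K + 1) * eta))).
{ eapply Rle_trans; [apply W6 |].
  - intros r hr; unfold norm, minus, plus, opp; simpl; unfold abs; simpl.
    specialize (B r hr); specialize (hVm r hr).
    replace (V r * P l r + - (V r * ((g (2 * r) + g 0) / 2)))
      with (V r * (P l r - (g (2 * r) + g 0) / 2)) by ring.
    rewrite Rabs_mult.
    apply Rle_trans with
      (Rabs (V r) * (K * RInt (fun t => Rabs (g t)) 0 (2 * r) + (2 * T * K + 1) * eta)).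
    + apply Rmult_le_compat_l; auto using Rabs_pos.
    + assert (0 <= (2 * T * K + 1) * eta) by (apply Rmult_le_pos; lra).
      pose proof (Rabs_pos (V r)); nra.
  - right; unfold plus, scal; simpl; unfold mult; simpl; ring. }
change (RInt (fun r => Rabs (V r) * (K * RInt (fun t => Rabs (g t)) 0 (2 * r))) 0 T) with J.
assert (B1 := B T ltac:(lra)); assert (B2 := app 0 ltac:(lra)).
set (G := RInt (fun t => Rabs (g t)) 0 (2 * T)) in *.
assert (B3 : Rabs ((Ht - H) * (cosh_sum l 0 - g 0)) <= Rabs (Ht - H) * eta).
{ rewrite Rabs_mult; apply Rmult_le_compat_l; auto. }
assert (B4 : Rabs ((ht - h) * (P l T - (g (2 * T) + g 0) / 2)) <=
             Rabs (ht - h) * (K * G + (2 * T * K + 1) * eta)).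
{ rewrite Rabs_mult; apply Rmult_le_compat_l; auto. }
apply Rabs_le_between in W7; apply Rabs_le_between in B3; apply Rabs_le_between in B4.
apply Rabs_le_between; lra.
Qed.
End Uniqueness.

(* [(x + |x|) / 2] is the positive part of [x]. *)
Definition tent (c e s : R) : R :=
  let x := 1 - Rabs (s - c) / e in (x + Rabs x) / 2.

Lemma tent_continuous (c e s : R) : continuous (tent c e) s.
Proof.
assert (c1 : continuous (fun s => 1 - Rabs (s - c) / e) s).
{ apply (continuous_minus (V := R_NormedModule) (fun _ => 1)); [apply continuous_const |].
  apply (continuous_mult (fun s => Rabs (s - c)) (fun _ => / e)); [| apply continuous_const].
  apply continuous_Rabs_comp, (continuous_minus (V := R_NormedModule) (fun s => s));
    [apply continuous_id | apply continuous_const]. }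
apply (continuous_mult (fun s => (1 - Rabs (s - c) / e) + Rabs (1 - Rabs (s - c) / e)) (fun _ => / 2));
  [| apply continuous_const].
apply (continuous_plus (V := R_NormedModule) (fun s => 1 - Rabs (s - c) / e)); auto.
apply continuous_Rabs_comp; auto.
Qed.

Lemma tent_ge0 (c e s : R) : 0 <= tent c e s.
Proof.
unfold tent; set (x := 1 - _).
pose proof (Rle_abs (- x)); rewrite Rabs_Ropp in H; lra.
Qed.

Lemma tent_center (c e : R) : tent c e c = 1.
Proof. unfold tent; rewrite Rminus_diag, Rabs_R0; unfold Rdiv; rewrite Rmult_0_l, Rminus_0_r, Rabs_R1; lra. Qed.

Lemma tent_le1 (c e s : R) : 0 < e -> tent c e s <= 1.
Proof.
intros e0; unfold tent; set (x := 1 - _).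
assert (0 <= Rabs (s - c) / e)
  by (apply Rmult_le_pos; [apply Rabs_pos | left; apply Rinv_0_lt_compat; auto]).
assert (x <= 1) by (unfold x; lra).
unfold Rabs; destruct Rcase_abs; lra.
Qed.

Lemma tent_out (c e s : R) : 0 < e -> e <= Rabs (s - c) -> tent c e s = 0.
Proof.
intros e0 hs; unfold tent; set (x := 1 - _).
assert (x <= 0).
{ unfold x; apply (Rmult_le_reg_r e); auto.
  unfold Rdiv; rewrite Rmult_minus_distr_r, Rmult_assoc, Rinv_l; lra. }
rewrite Rabs_left1; lra.
Qed.

Lemma tent_near (c e s : R) : 0 < e -> Rabs (s - c) <= e / 2 -> / 2 <= tent c e s.
Proof.
intros e0 hs; unfold tent; set (x := 1 - _).
assert (/ 2 <= x).
{ unfold x; apply (Rmult_le_reg_r e); auto.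
  unfold Rdiv; rewrite Rmult_minus_distr_r, Rmult_assoc, Rinv_l; lra. }
rewrite Rabs_pos_eq; lra.
Qed.

Lemma RInt_double (g : R -> R) (x y : R) :
  (forall t, continuous g t) -> RInt g (2 * x) (2 * y) = 2 * RInt (fun r => g (2 * r)) x y.
Proof.
intros cg.
replace (2 * x) with (2 * x + 0) by ring; replace (2 * y) with (2 * y + 0) by ring.
rewrite <- (RInt_comp_lin (V := R_CompleteNormedModule) g 2 0 x y)
  by (apply ex_RInt_continuous_everywhere; auto).
rewrite (RInt_scal (V := R_CompleteNormedModule) (fun r => g (2 * r + 0))).
- unfold scal; simpl; unfold mult; simpl; f_equal.
  apply RInt_ext; intros t _; rewrite Rplus_0_r; auto.
- apply ex_RInt_continuous_everywhere; intros t.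
  apply (continuous_comp (fun r => 2 * r + 0) g); auto.
  apply (continuous_plus (V := R_NormedModule) (fun r => 2 * r)); [| apply continuous_const].
  apply (continuous_mult (fun _ => 2)); [apply continuous_const | apply continuous_id].
Qed.

Lemma RInt_tent_zero (c e x y : R) :
  0 < e -> x <= y -> y <= c - e -> RInt (tent c e) x y = 0.
Proof.
intros e0 xy hy.
rewrite (RInt_ext (V := R_CompleteNormedModule) _ (fun _ => 0)).
- rewrite RInt_const; unfold scal; simpl; unfold mult; simpl; ring.
- intros t ht; rewrite Rmin_left, Rmax_right in ht by lra.
  apply tent_out; auto; rewrite Rabs_left; lra.
Qed.

(** * Peaked test functions and Gronwall's inequality *)

Section Gronwall.
Variables (T K a b : R) (V : R -> R).
Hypotheses (T0 : 0 < T) (K0 : 0 <= K) (cV : forall t, continuous V t)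
 (key : forall g : R -> R, (forall t, continuous g t) ->
  Rabs (RInt (fun r => V r * ((g (2 * r) + g 0) / 2)) 0 T
        - b * g 0 - a * ((g (2 * T) + g 0) / 2)) <=
  RInt (fun r => Rabs (V r) * (K * RInt (fun t => Rabs (g t)) 0 (2 * r))) 0 T
  + Rabs a * (K * RInt (fun t => Rabs (g t)) 0 (2 * T))).

(* Only the tail of [V] from [(c - e) / 2] on enters, since [int_0^{2r} tent = 0] before. *)
Lemma key_tent (c e : R) :
  0 < e -> e <= c <= 2 * T ->
  let J := RInt (fun r => tent c e (2 * r)) 0 T in
  Rabs (RInt (fun r => V r * tent c e (2 * r)) 0 T - a * tent c e (2 * T)) <=
  4 * K * J * (RInt (fun r => Rabs (V r)) ((c - e) / 2) T + Rabs a).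
Proof.
intros e0 hc J.
assert (k := key (tent c e) (tent_continuous c e)).
assert (ct := tent_continuous c e).
(* As [e <= c], the peak vanishes at 0: the term with [b] drops out and the mean keeps one value.
   Clearing its factor one half, together with the mass [2 * J] on [[0, 2 T]], produces the constant
   4. *)
rewrite (tent_out c e 0) in k by (auto; rewrite Rminus_0_l, Rabs_Ropp, Rabs_pos_eq; lra).
assert (Eabs : forall x y, RInt (fun t => Rabs (tent c e t)) x y = RInt (tent c e) x y).
{ intros x y; apply RInt_ext; intros t _; apply Rabs_pos_eq, tent_ge0. }
assert (EJ : RInt (tent c e) 0 (2 * T) = 2 * J).
{ unfold J; rewrite <- RInt_double, Rmult_0_r; auto. }
rewrite (Eabs 0 (2 * T)), EJ in k.
assert (cVt : forall t, continuous (fun r => V r * tent c e (2 * r)) t).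
{ intros t; apply (continuous_mult V); auto; apply continuous_comp_double; auto. }
rewrite (RInt_ext (V := R_CompleteNormedModule) _ (fun r => / 2 * (V r * tent c e (2 * r)))) in k
  by (intros; simpl; field).
rewrite (RInt_scal (V := R_CompleteNormedModule) (fun r => V r * tent c e (2 * r))) in k
  by (apply ex_RInt_continuous_everywhere; auto).
unfold scal in k; simpl in k; unfold mult in k; simpl in k.
assert (cM : forall t, continuous (fun r => Rabs (V r) * (K * RInt (fun t => Rabs (tent c e t)) 0 (2 * r))) t).
{ intros t; apply (continuous_mult (fun r => Rabs (V r))); [apply continuous_Rabs_comp; auto |].
  apply (continuous_mult (fun _ => K)); [apply continuous_const |].
  apply (continuous_RInt_double (fun t => Rabs (tent c e t))).
  intros; apply continuous_Rabs_comp; auto. }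
assert (exM : forall x y, ex_RInt (fun r => Rabs (V r) * (K * RInt (fun t => Rabs (tent c e t)) 0 (2 * r))) x y)
  by (intros; apply ex_RInt_continuous_everywhere; auto).
assert (exV : forall x y, ex_RInt (fun r => Rabs (V r)) x y)
  by (intros; apply ex_RInt_continuous_everywhere; intros; apply continuous_Rabs_comp; auto).
assert (M : RInt (fun r => Rabs (V r) * (K * RInt (fun t => Rabs (tent c e t)) 0 (2 * r))) 0 T
   <= 2 * K * J * RInt (fun r => Rabs (V r)) ((c - e) / 2) T).
{ rewrite <- (RInt_Chasles (V := R_CompleteNormedModule) _ 0 ((c - e) / 2) T) by auto.
  rewrite (RInt_ext (V := R_CompleteNormedModule) _ (fun _ => 0) 0 ((c - e) / 2)).
  - rewrite RInt_const; unfold scal, plus; simpl; unfold mult; simpl.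
    rewrite Rmult_0_r, Rplus_0_l.
    rewrite <- (RInt_scal (V := R_CompleteNormedModule) (fun r => Rabs (V r)) _ _ (2 * K * J)) by auto.
    apply RInt_le_on; auto; [lra | apply (ex_RInt_scal (V := R_NormedModule) (fun r => Rabs (V r))); auto |].
    intros r hr; unfold scal; simpl; unfold mult; simpl.
    rewrite Eabs.
    replace (2 * K * J * Rabs (V r)) with (Rabs (V r) * (K * (2 * J))) by ring.
    apply Rmult_le_compat_l; [apply Rabs_pos |]; apply Rmult_le_compat_l; auto.
    rewrite <- EJ; apply RInt_le_subinterval; auto; try lra; apply tent_ge0.
  - intros r hr; rewrite Rmin_left, Rmax_right in hr by lra.
    rewrite Eabs, RInt_tent_zero by lra; rewrite !Rmult_0_r; reflexivity. }
set (I := RInt (fun r => V r * tent c e (2 * r)) 0 T) in *.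
set (W := RInt (fun r => Rabs (V r)) ((c - e) / 2) T) in *.
apply Rabs_le_between in k; apply Rabs_le_between; lra.
Qed.

(** Permits division by the mass in [potential_le_tail]. Only the left half of the peak is used,
    since for [c = 2 T] the right half leaves the interval. *)
Lemma tent_mass_pos (c e : R) :
  0 < e -> e <= c <= 2 * T -> 0 < RInt (fun r => tent c e (2 * r)) 0 T.
Proof.
intros e0 hc.
apply Rlt_le_trans with (RInt (fun _ => / 2) ((c - e / 2) / 2) (c / 2)).
- rewrite RInt_const; unfold scal; simpl; unfold mult; simpl; lra.
- apply Rle_trans with (RInt (fun r => tent c e (2 * r)) ((c - e / 2) / 2) (c / 2)).
  + apply RInt_le_on; [lra | apply ex_RInt_const | |].
    * apply ex_RInt_continuous_everywhere; intros; apply continuous_comp_double, tent_continuous.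
    * intros r hr; apply tent_near; auto; rewrite Rabs_left1; lra.
  + apply (RInt_le_subinterval (fun r => tent c e (2 * r))); try lra.
    * intros; apply continuous_comp_double, tent_continuous.
    * intros; apply tent_ge0.
Qed.

Lemma tent_mass_le (e : R) :
  0 < e <= 2 * T -> RInt (fun r => tent (2 * T) e (2 * r)) 0 T <= e.
Proof.
intros he.
assert (ex : forall x y, ex_RInt (fun r => tent (2 * T) e (2 * r)) x y)
  by (intros; apply ex_RInt_continuous_everywhere; intros; apply continuous_comp_double, tent_continuous).
rewrite <- (RInt_Chasles (V := R_CompleteNormedModule) _ 0 (T - e / 2) T) by auto.
rewrite (RInt_ext (V := R_CompleteNormedModule) _ (fun _ => 0) 0 (T - e / 2)).
- assert (RInt (fun r => tent (2 * T) e (2 * r)) (T - e / 2) T <= RInt (fun _ => 1) (T - e / 2) T).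
  { apply RInt_le_on; auto; [lra | apply ex_RInt_const |]; intros; apply tent_le1; lra. }
  rewrite RInt_const in H; rewrite RInt_const; unfold scal, plus in *; simpl in *;
    unfold mult in *; simpl in *; lra.
- intros r hr; rewrite Rmin_left, Rmax_right in hr by lra.
  apply tent_out; [lra |]; rewrite Rabs_left; lra.
Qed.

(** A peak centred at [2 T] has value 1 there, so it detects [a] in full, while all other terms are
    bounded by its mass, at most [e]. *)
Lemma boundary_term_zero : a = 0.
Proof.
destruct (continuous_bounded V 0 T) as [Vm [Vm0 hVm]]; [lra | auto |].
set (W := RInt (fun r => Rabs (V r)) 0 T).
assert (exV : forall x y, ex_RInt (fun r => Rabs (V r)) x y)
  by (intros; apply ex_RInt_continuous_everywhere; intros; apply continuous_Rabs_comp; auto).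
assert (W0 : 0 <= W) by (apply RInt_nonneg; [lra | intros; apply continuous_Rabs_comp; auto | intros; apply Rabs_pos]).
pose proof (Rabs_pos a) as a0.
assert (c0 : 0 <= K * (W + Rabs a)) by (apply Rmult_le_pos; lra).
assert (Rabs a <= 0).
{ apply le_epsilon; intros d d0.
  (* [Vm] accounts for the integral of [V] against the peak, the next term for [key_tent]; with
     [J <= e <= d / C] this yields [Rabs a <= d]. *)
  set (C := Vm + 4 * (K * (W + Rabs a)) + 1).
  assert (C0 : 0 < C) by (unfold C; lra).
  set (e := Rmin (2 * T) (d / C)).
  assert (he : 0 < e <= 2 * T).
  { unfold e; split; [apply Rmin_glb_lt; [lra | apply Rdiv_lt_0_compat; auto] | apply Rmin_l]. }
  assert (k := key_tent (2 * T) e ltac:(lra) ltac:(lra)); simpl in k.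
  rewrite tent_center in k.
  assert (J1 := tent_mass_le e he); assert (J0 := tent_mass_pos (2 * T) e ltac:(lra) ltac:(lra)).
  assert (ct : forall t, continuous (fun r => tent (2 * T) e (2 * r)) t)
    by (intros; apply continuous_comp_double, tent_continuous).
  set (J := RInt (fun r => tent (2 * T) e (2 * r)) 0 T) in *.
  assert (I1 : Rabs (RInt (fun r => V r * tent (2 * T) e (2 * r)) 0 T) <= Vm * J).
  { eapply Rle_trans; [apply RInt_Rabs_le; [lra |] |].
    - apply ex_RInt_continuous_everywhere; intros; apply (continuous_mult V); auto.
    - unfold J; rewrite <- (RInt_scal (V := R_CompleteNormedModule) (fun r => tent (2 * T) e (2 * r)))
        by (apply ex_RInt_continuous_everywhere; auto).
      apply RInt_le_on; [lra | | |].
      + apply ex_RInt_continuous_everywhere; intros; apply continuous_Rabs_comp, (continuous_mult V); auto.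
      + apply (ex_RInt_scal (V := R_NormedModule) (fun r => tent (2 * T) e (2 * r))).
        apply ex_RInt_continuous_everywhere; auto.
      + intros t ht; unfold scal; simpl; unfold mult; simpl.
        rewrite Rabs_mult, (Rabs_pos_eq (tent _ _ _)) by apply tent_ge0.
        apply Rmult_le_compat_r; [apply tent_ge0 | auto]. }
  set (I := RInt (fun r => V r * tent (2 * T) e (2 * r)) 0 T) in *.
  assert (W1 : RInt (fun r => Rabs (V r)) ((2 * T - e) / 2) T <= W).
  { apply RInt_le_subinterval; try lra; [intros; apply continuous_Rabs_comp; auto | intros; apply Rabs_pos]. }
  assert (k1 : Rabs a <= C * J).
  { assert (4 * K * J * (RInt (fun r => Rabs (V r)) ((2 * T - e) / 2) T + Rabs a)
       <= 4 * K * J * (W + Rabs a)).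
    { apply Rmult_le_compat_l; [| lra]; repeat apply Rmult_le_pos; lra. }
    assert (E : Rabs a <= Rabs (I - a * 1) + Rabs I).
    { replace (Rabs a) with (Rabs ((I - a * 1) + - I)) at 1
        by (replace (I - a * 1 + - I) with (- a) by ring; apply Rabs_Ropp).
      eapply Rle_trans; [apply Rabs_triang |]; rewrite Rabs_Ropp; lra. }
    unfold C; nra. }
  assert (C * e <= d).
  { assert (e <= d / C) by apply Rmin_r.
    assert (C * (d / C) = d) by (field; lra); nra. }
  nra. }
destruct (Req_dec a 0) as [| na]; auto.
apply Rabs_pos_lt in na; lra.
Qed.

(** With [a = 0], both sides of [key_tent] are proportional to the mass [J] of the peak at [2 * r0].
    After division the left side is an average of [V] near [r0], which tends to [V r0]. *)
Lemma potential_le_tail (r0 : R) :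
  0 < r0 < T -> Rabs (V r0) <= 4 * K * RInt (fun r => Rabs (V r)) r0 T.
Proof.
intros hr0.
destruct (continuous_bounded V 0 T) as [Vm [Vm0 hVm]]; [lra | auto |].
assert (exV : forall x y, ex_RInt (fun r => Rabs (V r)) x y)
  by (intros; apply ex_RInt_continuous_everywhere; intros; apply continuous_Rabs_comp; auto).
assert (c0 : 0 <= K * Vm) by (apply Rmult_le_pos; auto).
apply Rle_of_le_plus_small with (c := 1 + 2 * (K * Vm)); [lra |].
intros eta eta0.
destruct (proj1 (filterlim_locally V (V r0)) (cV r0) (mkposreal eta eta0)) as [d hd].
simpl in hd; pose proof (cond_pos d) as d0.
(* [2 * r0] makes the peak vanish at 0, [eta] controls the error [Vm * (e / 2)] in the tail, and [d]
   confines the peak to where [V] is within [eta] of [V r0]. *)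
set (e := Rmin (Rmin (2 * r0) eta) d).
assert (he : 0 < e) by (unfold e; repeat apply Rmin_glb_lt; lra).
assert (he1 : e <= 2 * r0) by (unfold e; eapply Rle_trans; [apply Rmin_l | apply Rmin_l]).
assert (he2 : e <= eta) by (unfold e; eapply Rle_trans; [apply Rmin_l | apply Rmin_r]).
assert (he3 : e <= d) by (unfold e; apply Rmin_r).
assert (k := key_tent (2 * r0) e he ltac:(lra)); simpl in k.
rewrite boundary_term_zero, Rmult_0_l, Rminus_0_r, Rabs_R0, Rplus_0_r in k.
assert (J0 := tent_mass_pos (2 * r0) e he ltac:(lra)).
assert (ct : forall t, continuous (fun r => tent (2 * r0) e (2 * r)) t)
  by (intros; apply continuous_comp_double, tent_continuous).
assert (exJ : ex_RInt (fun r => tent (2 * r0) e (2 * r)) 0 T)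
  by (apply ex_RInt_continuous_everywhere; auto).
assert (exVt : ex_RInt (fun r => V r * tent (2 * r0) e (2 * r)) 0 T)
  by (apply ex_RInt_continuous_everywhere; intros; apply (continuous_mult V); auto).
set (J := RInt (fun r => tent (2 * r0) e (2 * r)) 0 T) in *.
set (I := RInt (fun r => V r * tent (2 * r0) e (2 * r)) 0 T) in *.
assert (I1 : Rabs (I - V r0 * J) <= eta * J).
{ assert (A1 := is_RInt_minus (V := R_NormedModule) _ _ _ _ _ _
    (RInt_correct (V := R_CompleteNormedModule) _ _ _ exVt)
    (is_RInt_scal (V := R_NormedModule) _ _ _ (V r0) _ (RInt_correct (V := R_CompleteNormedModule) _ _ _ exJ))).
  assert (A2 := is_RInt_scal (V := R_NormedModule) _ _ _ eta _ (RInt_correct (V := R_CompleteNormedModule) _ _ _ exJ)).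
  refine (@norm_RInt_le R_NormedModule _ _ 0 T _ _ (Rlt_le _ _ T0) _ A1 A2).
  intros t ht; unfold norm, minus, plus, opp, scal; simpl; unfold abs, mult; simpl.
  replace (V t * tent (2 * r0) e (2 * t) + - (V r0 * tent (2 * r0) e (2 * t)))
    with ((V t - V r0) * tent (2 * r0) e (2 * t)) by ring.
  rewrite Rabs_mult, (Rabs_pos_eq (tent _ _ _)) by apply tent_ge0.
  destruct (Rle_or_lt e (Rabs (2 * t - 2 * r0))) as [far | near].
  - rewrite tent_out by auto; lra.
  - apply Rmult_le_compat_r; [apply tent_ge0 |].
    left; apply hd.
    unfold ball; simpl; unfold AbsRing_ball, abs, minus, plus, opp; simpl.
    replace (2 * t - 2 * r0) with (2 * (t - r0)) in near by ring.
    rewrite Rabs_mult, (Rabs_pos_eq 2) in near by lra.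
    pose proof (Rabs_pos (t - r0)); unfold Rminus in *; lra. }
assert (W1 : RInt (fun r => Rabs (V r)) ((2 * r0 - e) / 2) T <=
             RInt (fun r => Rabs (V r)) r0 T + Vm * (e / 2)).
{ rewrite <- (RInt_Chasles (V := R_CompleteNormedModule) _ ((2 * r0 - e) / 2) r0 T) by auto.
  assert (RInt (fun r => Rabs (V r)) ((2 * r0 - e) / 2) r0 <= RInt (fun _ => Vm) ((2 * r0 - e) / 2) r0).
  { apply RInt_le_on; auto; [lra | apply ex_RInt_const |]; intros t ht; apply hVm; lra. }
  rewrite RInt_const in H; unfold scal, plus in *; simpl in *; unfold mult in *; simpl in *; lra. }
set (W := RInt (fun r => Rabs (V r)) r0 T) in *.
assert (k1 : Rabs (V r0) * J <= (eta + 4 * K * (W + Vm * (e / 2))) * J).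
{ replace (Rabs (V r0) * J) with (Rabs (V r0 * J))
    by (rewrite Rabs_mult, (Rabs_pos_eq J); lra).
  assert (A : 4 * K * J * RInt (fun r => Rabs (V r)) ((2 * r0 - e) / 2) T
           <= 4 * K * J * (W + Vm * (e / 2))).
  { apply Rmult_le_compat_l; [repeat apply Rmult_le_pos; lra | lra]. }
  apply Rabs_le_between in I1; apply Rabs_le_between in k; apply Rabs_le_between; lra. }
apply Rmult_le_reg_r in k1; auto.
assert (K * Vm * e <= K * Vm * eta) by (apply Rmult_le_compat_l; auto).
lra.
Qed.

Lemma potential_zero (r0 : R) : 0 < r0 < T -> V r0 = 0.
Proof.
intros hr0.
destruct (continuous_bounded V 0 T) as [Vm [Vm0 hVm]]; [lra | auto |].
assert (cA : forall t, continuous (fun r => Rabs (V r)) t)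
  by (intros; apply continuous_Rabs_comp; auto).
assert (exV : forall x y, ex_RInt (fun r => Rabs (V r)) x y)
  by (intros; apply ex_RInt_continuous_everywhere; auto).
set (S := fun r => RInt (fun r => Rabs (V r)) r T).
set (C := 4 * K).
assert (C0 : 0 <= C) by (unfold C; lra).
assert (DS : forall r, is_derive S r (- Rabs (V r))).
{ intros r; apply (is_derive_RInt' (fun r => Rabs (V r)) S r T); auto.
  exists (mkposreal 1 Rlt_0_1); intros y _; apply (RInt_correct (V := R_CompleteNormedModule)); auto. }
(* Backward Gronwall: the derivative of [exp (C r) S r] is nonnegative by [potential_le_tail]. That
   bound holds in the open interval only, so [S T = 0] is reached through [t] tending to [T]. *)
assert (G : forall t, r0 <= t < T -> exp (C * r0) * S r0 <= exp (C * t) * S t).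
{ intros t ht.
  apply (nondecreasing_of_derive (fun r => exp (C * r) * S r)
    (fun r => exp (C * r) * (C * S r - Rabs (V r)))); [lra | |].
  - intros r hr; auto_derive; [eexists; apply DS |].
    change (fun x => S x) with S; rewrite (is_derive_unique _ _ _ (DS r)); ring.
  - intros r hr; apply Rmult_le_pos; [left; apply exp_pos |].
    assert (P := potential_le_tail r ltac:(lra)); fold (S r) in P; fold C in P; lra. }
assert (S0 : S r0 <= 0).
{ apply (Rmult_le_reg_l (exp (C * r0))); [apply exp_pos |]; rewrite Rmult_0_r.
  apply Rle_of_le_plus_small with (c := exp (C * T) * Vm).
  { apply Rmult_le_pos; [left; apply exp_pos | auto]. }
  intros eta eta0.
  set (t := Rmax r0 (T - eta)).
  assert (ht : r0 <= t < T) by (unfold t; split; [apply Rmax_l | apply Rmax_lub_lt; lra]).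
  assert (ht2 : T - eta <= t) by apply Rmax_r.
  eapply Rle_trans; [apply (G t ht) |].
  assert (S1 : S t <= Vm * eta).
  { assert (S t <= RInt (fun _ => Vm) t T).
    { apply RInt_le_on; auto; [lra | apply ex_RInt_const |]; intros; apply hVm; lra. }
    rewrite RInt_const in H; unfold scal in H; simpl in H; unfold mult in H; simpl in H; nra. }
  assert (S2 : 0 <= S t) by (apply RInt_nonneg; auto; [lra | intros; apply Rabs_pos]).
  assert (E : exp (C * t) <= exp (C * T)).
  { destruct (Req_dec C 0) as [-> | nC]; [rewrite !Rmult_0_l; lra |].
    left; apply exp_increasing; nra. }
  pose proof (exp_pos (C * t)).
  rewrite Rplus_0_l, Rmult_assoc; apply Rmult_le_compat; lra. }
assert (P := potential_le_tail r0 hr0); fold (S r0) in P; fold C in P.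
destruct (Req_dec (V r0) 0) as [| nV]; auto.
apply Rabs_pos_lt in nV; nra.
Qed.

Lemma initial_term_zero : b = 0.
Proof.
assert (k := key (fun _ => 1) (fun t => continuous_const 1 t)); cbv beta in k.
rewrite (RInt_ext (V := R_CompleteNormedModule) (fun r => V r * ((1 + 1) / 2)) (fun _ => 0)) in k.
2:{ intros r hr; rewrite Rmin_left, Rmax_right in hr by lra; simpl.
    rewrite potential_zero by lra; ring. }
rewrite (RInt_ext (V := R_CompleteNormedModule) (fun r => Rabs (V r) * _) (fun _ => 0)) in k.
2:{ intros r hr; rewrite Rmin_left, Rmax_right in hr by lra; simpl.
    rewrite potential_zero, Rabs_R0 by lra; ring. }
rewrite boundary_term_zero, Rabs_R0, RInt_const in k.
unfold scal in k; simpl in k; unfold mult in k; simpl in k.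
apply Rabs_le_between in k; lra.
Qed.
End Gronwall.

Theorem schrodinger_weyl_uniqueness (T k0 H Ht h ht : R) (Q Qt : R -> R)
    (Y Z Yt Zt : R -> R -> R) :
  0 < T -> 0 < k0 -> (forall t, continuous Q t) -> (forall t, continuous Qt t) ->
  sol_family T k0 H Q Y Z -> sol_family T k0 Ht Qt Yt Zt ->
  (forall k, k0 <= k ->
     Y k T * (ht * Yt k T + Zt k T) = Yt k T * (h * Y k T + Z k T)) ->
  (forall r, 0 < r < T -> Q r = Qt r) /\ h = ht /\ H = Ht.
Proof.
intros T0 k0p cQ cQt S St W.
destruct (key_inequality T k0 H Ht h ht Q Qt Y Z Yt Zt T0 k0p cQ cQt S St W) as [K [K0 key]].
assert (cV : forall t, continuous (fun r => Q r - Qt r) t)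
  by (intros; apply (continuous_minus (V := R_NormedModule) Q Qt); auto).
pose proof (boundary_term_zero T K _ _ _ T0 K0 cV key).
pose proof (initial_term_zero T K _ _ _ T0 K0 cV key).
repeat split; try lra.
intros r hr; pose proof (potential_zero T K _ _ _ T0 K0 cV key r hr); simpl in *; lra.
Qed.

(** * Reduction to the real equation *)

(** The energy [Y ^ 2 + Z ^ 2] has derivative [2 Y Z (1 + Q + k ^ 2)], so it grows at rate at most
    [M]. This serves to show that [psi] is real at real parameters. *)
Lemma ode_sol_zero (T k : R) (Q Y Z : R -> R) (r : R) :
  (forall t, continuous Q t) -> ode_sol T k Q Y Z -> Y 0 = 0 -> Z 0 = 0 ->
  0 <= r <= T -> Y r = 0 /\ Z r = 0.
Proof.
intros cQ S Y0 Z0 hr.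
destruct (continuous_bounded (fun t => 1 + (Q t + k ^ 2)) 0 T) as [M [M0 hM]]; [lra | |].
{ intros t _; apply (continuous_plus (V := R_NormedModule) (fun _ => 1)); [apply continuous_const |].
  apply (continuous_plus (V := R_NormedModule) Q); [auto | apply continuous_const]. }
pose (E := fun t => exp (- M * t) * (Y t ^ 2 + Z t ^ 2)).
assert (h : - E 0 <= - E r).
{ apply (nondecreasing_of_derive (fun t => - E t)
    (fun t => exp (- M * t) * (M * (Y t ^ 2 + Z t ^ 2) - 2 * (Y t * Z t) * (1 + (Q t + k ^ 2)))));
    [lra | |].
  - intros t ht; destruct (S t) as [DY DZ]; [lra |].
    unfold E; auto_derive; [repeat split; eexists; eauto |].
    change (fun x => Y x) with Y; change (fun x => Z x) with Z.
    rewrite (is_derive_unique _ _ _ DY), (is_derive_unique _ _ _ DZ); ring.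
  - intros t ht; apply Rmult_le_pos; [left; apply exp_pos |].
    specialize (hM t ltac:(lra)); apply Rabs_le_between in hM.
    assert (2 * (Y t * Z t) * (1 + (Q t + k ^ 2)) <= Rabs (2 * (Y t * Z t)) * M).
    { eapply Rle_trans; [apply Rle_abs |]; rewrite Rabs_mult.
      apply Rmult_le_compat_l; [apply Rabs_pos | apply Rabs_le_between; auto]. }
    assert (Rabs (2 * (Y t * Z t)) <= Y t ^ 2 + Z t ^ 2).
    { pose proof (pow2_ge_0 (Y t + Z t)); pose proof (pow2_ge_0 (Y t - Z t)).
      apply Rabs_le_between; lra. }
    nra. }
unfold E in h; rewrite Y0, Z0 in h.
pose proof (exp_pos (- M * r)).
pose proof (pow2_ge_0 (Y r)); pose proof (pow2_ge_0 (Z r)).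
assert (Y r ^ 2 + Z r ^ 2 <= 0) by nra.
split; apply Rsqr_0_uniq; unfold Rsqr; nra.
Qed.

(* Riccati comparison in product form: with [F = Z - l Y] and [l] affine from [H] to
   [|h| + 1], [(Y F)' = F^2 + (Q + k^2 - l' - l^2) Y^2], which is nonnegative for large [k]. *)
Lemma delta_nonzero (T H h : R) (Q : R -> R) :
  0 < T -> (forall t, continuous Q t) ->
  exists k1, 0 < k1 /\ forall k Y Z, k1 <= k -> ode_sol T k Q Y Z -> Y 0 = 1 -> Z 0 = H ->
    h * Y T + Z T <> 0.
Proof.
intros T0 cQ.
destruct (continuous_bounded Q 0 T) as [Qm [Qm0 hQm]]; [lra | auto |].
(* The start [l 0 = H] makes [Y F] vanish at 0; the end value [Rabs h + 1] exceeds [- h], which is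
   what contradicts [h * Y T + Z T = 0]. *)
pose (m := (Rabs h + 1 - H) / T); pose (L := Rabs H + Rabs h + 1).
pose proof (Rabs_pos H); pose proof (Rabs_pos h); pose proof (Rabs_pos m).
pose proof (pow2_ge_0 L).
(* The 1 gives [k <= k ^ 2]; the other terms absorb the worst values of [Q], of the slope [m] and of
   [l ^ 2]. *)
exists (1 + Qm + Rabs m + L ^ 2); split; [lra |].
intros k Y Z hk S Y0 Z0.
pose (l := fun r => H + m * r).
assert (lT : l T = Rabs h + 1) by (unfold l, m; field; lra).
assert (lb : forall r, 0 <= r <= T -> Rabs (l r) <= L).
{ intros r hr.
  assert (E : l r = (1 - r / T) * H + r / T * (Rabs h + 1)) by (unfold l, m; field; lra).
  assert (0 <= r / T <= 1).
  { split; [apply Rmult_le_pos; [lra | left; apply Rinv_0_lt_compat; lra] |].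
    apply (Rmult_le_reg_r T); auto; unfold Rdiv; rewrite Rmult_assoc, Rinv_l; lra. }
  pose proof (proj1 (Rabs_le_between H _) (Rle_refl _)).
  rewrite E; apply Rabs_le_between; unfold L; nra. }
assert (P : forall r, 0 <= r <= T -> l r * Y r ^ 2 <= Y r * Z r).
{ intros r hr.
  assert (h0 : Y 0 * Z 0 - l 0 * Y 0 ^ 2 <= Y r * Z r - l r * Y r ^ 2).
  { apply (nondecreasing_of_derive (fun t => Y t * Z t - l t * Y t ^ 2)
      (fun t => (Z t - l t * Y t) ^ 2 + (Q t + k ^ 2 - m - l t ^ 2) * Y t ^ 2)); [lra | |].
    - intros t ht; destruct (S t) as [DY DZ]; [lra |].
      unfold l; auto_derive; [repeat split; eexists; eauto |].
      change (fun x => Y x) with Y; change (fun x => Z x) with Z.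
      rewrite (is_derive_unique _ _ _ DY), (is_derive_unique _ _ _ DZ); ring.
    - intros t ht.
      specialize (hQm t ltac:(lra)); specialize (lb t ltac:(lra)).
      apply Rabs_le_between in hQm.
      assert (l t ^ 2 <= L ^ 2).
      { rewrite <- (pow2_abs (l t)); apply pow_incr; split; [apply Rabs_pos | auto]. }
      pose proof (Rle_abs m).
      assert (k <= k ^ 2) by nra.
      apply Rplus_le_le_0_compat; [apply pow2_ge_0 |].
      apply Rmult_le_pos; [lra | apply pow2_ge_0]. }
  rewrite Y0, Z0 in h0; unfold l in h0 at 1; nra. }
(* Here [Y T <> 0] is secured: [Y Z >= l Y ^ 2 >= - L Y ^ 2] makes [exp (2 L t) Y ^ 2] nondecreasing
   from the value 1. *)
assert (G : exp (2 * L * 0) * Y 0 ^ 2 <= exp (2 * L * T) * Y T ^ 2).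
{ apply (nondecreasing_of_derive (fun t => exp (2 * L * t) * Y t ^ 2)
    (fun t => exp (2 * L * t) * (2 * (Y t * Z t) + 2 * L * Y t ^ 2))); [lra | |].
  - intros t ht; destruct (S t) as [DY DZ]; [lra |].
    auto_derive; [repeat split; eexists; eauto |].
    change (fun x => Y x) with Y.
    rewrite (is_derive_unique _ _ _ DY); ring.
  - intros t ht; apply Rmult_le_pos; [left; apply exp_pos |].
    specialize (P t ltac:(lra)); specialize (lb t ltac:(lra)); apply Rabs_le_between in lb.
    pose proof (pow2_ge_0 (Y t)); nra. }
rewrite Y0, Rmult_0_r, exp_0 in G.
intros D.
specialize (P T ltac:(lra)); rewrite lT in P.
replace (Z T) with (- h * Y T) in P by lra.
pose proof (pow2_ge_0 (Y T)); pose proof (exp_pos (2 * L * T)).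
pose proof (Rle_abs (- h)); rewrite Rabs_Ropp in *.
assert (Y T ^ 2 <= 0) by nra.
nra.
Qed.

Lemma ode_sol_wronskian (T k : R) (Q Y Z U W : R -> R) :
  0 <= T -> ode_sol T k Q Y Z -> ode_sol T k Q U W ->
  Y T * W T - Z T * U T = Y 0 * W 0 - Z 0 * U 0.
Proof.
intros T0 S1 S2.
apply (constant_of_derive_zero (fun r => Y r * W r - Z r * U r)); auto.
intros r hr; destruct (S1 r hr) as [DY DZ], (S2 r hr) as [DU DW].
auto_derive; [repeat split; eexists; eauto |].
change (fun x => Y x) with Y; change (fun x => Z x) with Z.
change (fun x => U x) with U; change (fun x => W x) with W.
rewrite (is_derive_unique _ _ _ DY), (is_derive_unique _ _ _ DZ),
  (is_derive_unique _ _ _ DU), (is_derive_unique _ _ _ DW); ring.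
Qed.

(** Conformable derivatives are given on the open interval only; continuity carries the formula to
    the endpoints. *)
Lemma RInt_of_derive_open (G g : R -> R) (T r : R) :
  (forall t, continuous G t) -> (forall t, continuous g t) ->
  (forall t, 0 < t < T -> is_derive G t (g t)) -> 0 <= r <= T ->
  G r = G 0 + RInt g 0 r.
Proof.
intros cG cg D hr.
assert (DI : forall t, is_derive (fun x => RInt g 0 x) t (g t)).
{ intros t; apply (is_derive_RInt g (fun x => RInt g 0 x) 0); [| auto].
  exists (mkposreal 1 Rlt_0_1); intros y _.
  apply (RInt_correct (V := R_CompleteNormedModule)), ex_RInt_continuous_everywhere; auto. }
destruct (MVT_gen (fun t => G t - RInt g 0 t) 0 r (fun _ => 0)) as [c [_ e]].
- intros t ht; rewrite Rmin_left, Rmax_right in ht by lra.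
  assert (D0 : is_derive (fun t => G t - RInt g 0 t) t (g t - g t))
    by (apply (is_derive_minus G (fun x => RInt g 0 x)); auto; apply D; lra).
  rewrite Rminus_diag in D0; exact D0.
- intros t _; apply continuity_pt_filterlim.
  apply (continuous_minus (V := R_NormedModule) G (fun x => RInt g 0 x)); auto.
  apply (ex_derive_continuous (fun x => RInt g 0 x)); eexists; apply DI.
- rewrite RInt_point in e; unfold zero in e; simpl in e; lra.
Qed.

Lemma eq_zero_closed_of_open (V : R -> R) (T r : R) :
  0 < T -> (forall t, continuous V t) -> (forall t, 0 < t < T -> V t = 0) ->
  0 <= r <= T -> V r = 0.
Proof.
intros T0 cV hV hr.
destruct (Req_dec (V r) 0) as [| nV]; auto; exfalso.
destruct (proj1 (filterlim_locally V (V r)) (cV r) (mkposreal _ (Rabs_pos_lt _ nV))) as [d hd].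
simpl in hd; pose proof (cond_pos d).
assert (hm : 0 < Rmin (d / 2) (T / 2)) by (apply Rmin_glb_lt; lra).
pose proof (Rmin_l (d / 2) (T / 2)); pose proof (Rmin_r (d / 2) (T / 2)).
set (e := Rmin (d / 2) (T / 2)) in *.
assert (ex : exists t, 0 < t < T /\ Rabs (t - r) < d).
{ destruct (Rle_or_lt r (T / 2)).
  - exists (r + e / 2); split; [lra |].
    replace (r + e / 2 - r) with (e / 2) by ring; rewrite Rabs_pos_eq; lra.
  - exists (r - e / 2); split; [lra |].
    replace (r - e / 2 - r) with (- (e / 2)) by ring; rewrite Rabs_Ropp, Rabs_pos_eq; lra. }
destruct ex as [t [ht1 ht2]].
specialize (hd t ht2); rewrite (hV t ht1) in hd.
unfold ball in hd; simpl in hd; unfold AbsRing_ball, abs, minus, plus, opp in hd; simpl in hd.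
rewrite Rplus_0_l, Rabs_Ropp in hd; lra.
Qed.

(* [Rpower] is junk on nonpositive bases ([Rpower 0 p = 1]), hence the test. *)
Definition pos_power (p y : R) : R := if Rle_dec y 0 then 0 else Rpower y p.

Lemma pos_power_continuous (p y : R) : 0 < p -> continuous (pos_power p) y.
Proof.
intros p0.
destruct (Rlt_or_le 0 y) as [hy | hy].
- apply (continuous_ext_loc (pos_power p) (fun t => Rpower t p)).
  + exists (mkposreal y hy); intros t ht.
    unfold ball in ht; simpl in ht; unfold AbsRing_ball, abs, minus, plus, opp in ht; simpl in ht.
    apply Rabs_lt_between in ht.
    unfold pos_power; destruct Rle_dec; [lra | auto].
  + apply (ex_derive_continuous (fun t => Rpower t p)); unfold Rpower; auto_derive; lra.
- apply filterlim_locally; intros eps.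
  (* The radius is [eps] to the power [1 / p]. *)
  exists (mkposreal _ (exp_pos (ln eps / p))); intros t ht; simpl in ht.
  unfold ball in *; simpl in *; unfold AbsRing_ball, abs, minus, plus, opp in *; simpl in *.
  assert (E : pos_power p y = 0) by (unfold pos_power; destruct Rle_dec; [auto | lra]).
  rewrite E, Ropp_0, Rplus_0_r.
  unfold pos_power; destruct Rle_dec as [ht0 | ht0].
  + rewrite Rabs_R0; apply cond_pos.
  + apply Rnot_le_lt in ht0.
    apply Rabs_lt_between in ht.
    rewrite Rabs_pos_eq by (left; apply exp_pos).
    rewrite <- (exp_ln eps) by apply cond_pos.
    unfold Rpower; apply exp_increasing.
    assert (L : ln t < ln eps / p).
    { rewrite <- (ln_exp (ln eps / p)); apply ln_increasing; lra. }
    apply (Rmult_lt_compat_l p) in L; auto.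
    replace (p * (ln eps / p)) with (ln eps) in L by (field; lra); lra.
Qed.

Definition length_T (a : R) : R := Rpower PI a / a.

(* The variable [r = T - x^a / a] turns [D^a] into [- d/dr]; [xvar] is its inverse,
   extended by constants outside [[0, T]]. *)
Definition xvar (a r : R) : R := pos_power (/ a) (a * (length_T a - (r + Rabs r) / 2)).

(** * The change of variable from [x] to [r] *)

Section ChangeOfVariable.
Variable (a : R).
Hypothesis (a0 : 0 < a).
Let T := length_T a.

Lemma length_T_pos : 0 < T.
Proof. apply Rdiv_lt_0_compat; auto; apply exp_pos. Qed.

Lemma xvar_continuous (r : R) : continuous (xvar a) r.
Proof.
apply (continuous_comp (fun r => a * (length_T a - (r + Rabs r) / 2)) (pos_power (/ a))).
- apply (continuous_mult (fun _ => a)); [apply continuous_const |].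
  apply (continuous_minus (V := R_NormedModule) (fun _ => length_T a)); [apply continuous_const |].
  apply (continuous_mult (fun r => r + Rabs r) (fun _ => / 2)); [| apply continuous_const].
  apply (continuous_plus (V := R_NormedModule) (fun r => r)); [apply continuous_id | apply continuous_Rabs].
- apply pos_power_continuous, Rinv_0_lt_compat, a0.
Qed.

Lemma xvar_in (r : R) : Ipi (xvar a r).
Proof.
unfold Ipi, xvar, pos_power; pose proof PI_RGT_0; destruct Rle_dec as [h | h]; [lra |].
apply Rnot_le_lt in h; split; [left; apply exp_pos |].
rewrite <- (Rpower_1 PI) by auto.
replace 1 with (a * / a) by (field; lra).
rewrite <- Rpower_mult.
apply Rle_Rpower_l; [left; apply Rinv_0_lt_compat, a0 |]; split; auto.
assert (0 <= (r + Rabs r) / 2) by (pose proof (Rle_abs (- r)); rewrite Rabs_Ropp in *; lra).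
unfold length_T; replace (Rpower PI a) with (a * (Rpower PI a / a)) at 2 by (field; lra).
apply Rmult_le_compat_l; lra.
Qed.

Lemma xvar_open (r : R) : 0 <= r < T -> xvar a r = Rpower (a * (T - r)) (/ a).
Proof.
intros hr; unfold xvar, pos_power; rewrite Rabs_pos_eq by lra.
replace ((r + r) / 2) with r by field; fold T.
destruct Rle_dec as [h | h]; auto.
assert (0 < a * (T - r)) by (apply Rmult_lt_0_compat; lra); lra.
Qed.

Lemma xvar_surj (x : R) : 0 < x < PI -> exists r, 0 < r < T /\ xvar a r = x.
Proof.
intros hx; exists (T - Rpower x a / a).
assert (0 < Rpower x a / a) by (apply Rdiv_lt_0_compat; auto; apply exp_pos).
assert (Rpower x a / a < T).
{ apply Rmult_lt_compat_r; [apply Rinv_0_lt_compat; auto | apply Rlt_Rpower_l; lra]. }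
split; [lra |].
rewrite xvar_open by lra.
replace (a * (T - (T - Rpower x a / a))) with (Rpower x a) by (field; lra).
rewrite Rpower_mult, Rinv_r, Rpower_1; lra.
Qed.

Lemma xvar_0 : xvar a 0 = PI.
Proof.
pose proof length_T_pos; rewrite xvar_open by lra.
unfold T, length_T; replace (a * (Rpower PI a / a - 0)) with (Rpower PI a) by (field; lra).
rewrite Rpower_mult, Rinv_r, Rpower_1; try lra; apply PI_RGT_0.
Qed.

Lemma xvar_T : xvar a T = 0.
Proof.
pose proof length_T_pos; unfold xvar, pos_power; rewrite Rabs_pos_eq by lra; fold T.
destruct Rle_dec as [h | h]; auto; exfalso; apply h; right; field.
Qed.

Lemma xvar_interior (r : R) : 0 < r < T -> 0 < xvar a r < PI.
Proof.
intros hr; split; [rewrite xvar_open by lra; apply exp_pos |].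
rewrite <- xvar_0, !xvar_open by lra.
apply Rlt_Rpower_l; [apply Rinv_0_lt_compat; auto |].
split; [apply Rmult_lt_0_compat; lra |].
apply Rmult_lt_compat_l; lra.
Qed.

Lemma xvar_derive (r : R) :
  0 < r < T -> is_derive (xvar a) r (- Rpower (xvar a r) (1 - a)).
Proof.
intros hr.
apply (is_derive_ext_loc (fun r => Rpower (a * (T - r)) (/ a))).
{ assert (hm : 0 < Rmin r (T - r)) by (apply Rmin_glb_lt; lra).
  exists (mkposreal _ hm); intros t ht.
  unfold ball in ht; simpl in ht; unfold AbsRing_ball, abs, minus, plus, opp in ht; simpl in ht.
  apply Rabs_lt_between in ht.
  pose proof (Rmin_l r (T - r)); pose proof (Rmin_r r (T - r)).
  symmetry; apply xvar_open; lra. }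
assert (p : 0 < a * (T - r)) by (apply Rmult_lt_0_compat; lra).
rewrite xvar_open, Rpower_mult by lra.
replace (/ a * (1 - a)) with (/ a - 1) by (field; lra).
unfold Rpower; auto_derive.
- auto.
- replace ((/ a - 1) * ln (a * (T - r))) with (/ a * ln (a * (T - r)) + - ln (a * (T - r))) by ring.
  rewrite exp_plus, exp_Ropp, exp_ln by auto; unfold Rminus in *; field; split; lra.
Qed.

(** The reason for extending [xvar] to the whole line with values in [[0, PI]]: continuity relative
    to the interval becomes continuity everywhere. *)
Lemma continuous_comp_xvar {V : UniformSpace} (f : R -> V) (r : R) :
  cont_on_Ipi f -> continuous (fun r => f (xvar a r)) r.
Proof.
intros cf; specialize (cf (xvar a r) (xvar_in r)).
unfold continuous.
apply (filterlim_comp _ _ _ (xvar a) f _ (within Ipi (locally (xvar a r)))); auto.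
intros P hP; assert (c := xvar_continuous r _ hP).
unfold filtermap in *; apply (filter_imp (fun t => Ipi (xvar a t) -> P (xvar a t))); auto.
intros t ht; apply ht, xvar_in.
Qed.

(** At a real spectral parameter the real and imaginary parts solve the same real equation, so both
    are handled at once. *)
Definition coordinate (pr : C -> R) : Prop := pr = fst \/ pr = snd.

Lemma continuous_coordinate (pr : C -> R) (z : C) : coordinate pr -> continuous pr z.
Proof.
intros [-> | ->]; [apply (continuous_fst (U := R_UniformSpace) (V := R_UniformSpace)) |
                   apply (continuous_snd (U := R_UniformSpace) (V := R_UniformSpace))].
Qed.

(* [f (xvar r')] is the conformable difference quotient function at
   [eps = (xvar r' - x) / x^(1-a)], and this [eps] has derivative [-1]. *)
Lemma cfd_derive (f : R -> C) (l : C) (pr : C -> R) (r : R) :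
  coordinate pr -> 0 < r < T -> is_cfd a f (xvar a r) l ->
  is_derive (fun r => pr (f (xvar a r))) r (- pr l).
Proof.
intros hpr hr cfd.
set (x := xvar a r) in *; set (w := Rpower x (1 - a)).
assert (w0 : 0 < w) by apply exp_pos.
assert (D : is_derive (fun e => pr (f (x + e * w))) 0 (pr l)).
{ apply is_derive_Reals; intros eps eps0.
  assert (c := filterlim_comp _ _ _ _ pr _ _ _ cfd (continuous_coordinate pr l hpr)).
  destruct (proj1 (filterlim_locally _ (pr l)) c (mkposreal eps eps0)) as [d hd].
  exists d; intros e ne he.
  specialize (hd e); simpl in hd.
  assert (be : ball 0 d e).
  { unfold ball; simpl; unfold AbsRing_ball, abs, minus, plus, opp; simpl.
    rewrite Ropp_0, Rplus_0_r; auto. }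
  specialize (hd be ne).
  unfold ball in hd; simpl in hd; unfold AbsRing_ball, abs, minus, plus, opp in hd; simpl in hd.
  rewrite Rplus_0_l, Rmult_0_l, Rplus_0_r.
  assert (E : pr (scal (/ e) (minus (f (x + e * w)) (f x))) = (pr (f (x + e * w)) - pr (f x)) / e).
  { destruct hpr as [-> | ->]; unfold scal, minus, plus, opp; simpl;
      unfold scal, plus, opp; simpl; unfold mult; simpl; field; auto. }
  rewrite <- E; exact hd. }
assert (Dx := xvar_derive r hr); fold x w in Dx.
assert (De : is_derive (fun t => (xvar a t - x) / w) r (- 1)).
{ auto_derive; [eexists; exact Dx |].
  change (fun x0 => xvar a x0) with (xvar a).
  rewrite (is_derive_unique _ _ _ Dx); field; lra. }
apply (is_derive_ext (fun t => (fun e => pr (f (x + e * w))) ((xvar a t - x) / w))).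
{ intros t; simpl; do 2 f_equal; field; lra. }
replace (- pr l) with (scal (- 1) (pr l)) by (unfold scal; simpl; unfold mult; simpl; ring).
apply (is_derive_comp (fun e => pr (f (x + e * w)))); auto.
fold x; replace ((x - x) / w) with 0 by (field; lra); auto.
Qed.
End ChangeOfVariable.

Definition lam_of (k : R) : C := RtoC (- k ^ 2).

(* On [[0, T]] these are [pr y] and [- pr Dy] in the variable [r]; written as
   primitives they are differentiable at the endpoints too. *)
Definition reg_Z (a : R) (q : R -> R) (pr : C -> R) (k : R) (y Dy : R -> C) (r : R) : R :=
  - pr (Dy PI) + RInt (fun p => (q (xvar a p) + k ^ 2) * pr (y (xvar a p))) 0 r.

Definition reg_Y (a : R) (q : R -> R) (pr : C -> R) (k : R) (y Dy : R -> C) (r : R) : R :=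
  pr (y PI) + RInt (reg_Z a q pr k y Dy) 0 r.

Lemma is_derive_RInt_everywhere (g : R -> R) (c t : R) :
  (forall t, continuous g t) -> is_derive (fun x => c + RInt g 0 x) t (g t).
Proof.
intros cg; rewrite <- (Rplus_0_l (g t)).
apply (is_derive_plus (V := R_NormedModule) (fun _ => c) (fun x => RInt g 0 x)).
- apply (is_derive_const c).
- apply (is_derive_RInt g (fun x => RInt g 0 x) 0); [| auto].
  exists (mkposreal 1 Rlt_0_1); intros y _.
  apply (RInt_correct (V := R_CompleteNormedModule)), ex_RInt_continuous_everywhere; auto.
Qed.

Lemma reg_sol (a : R) (q : R -> R) (pr : C -> R) (k : R) (y Dy : R -> C) :
  0 < a -> cont_on_Ipi q -> coordinate pr -> is_sol a q (lam_of k) y Dy ->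
  ode_sol (length_T a) k (fun r => q (xvar a r)) (reg_Y a q pr k y Dy) (reg_Z a q pr k y Dy) /\
  forall r, 0 <= r <= length_T a ->
    reg_Y a q pr k y Dy r = pr (y (xvar a r)) /\ reg_Z a q pr k y Dy r = - pr (Dy (xvar a r)).
Proof.
intros a0 cq hpr [cy [cDy [S1 S2]]].
set (Y := fun r => pr (y (xvar a r))); set (Z := fun r => - pr (Dy (xvar a r))).
set (W := fun p => (q (xvar a p) + k ^ 2) * Y p).
assert (cpr : forall f : R -> C, cont_on_Ipi f -> forall r, continuous (fun r => pr (f (xvar a r))) r).
{ intros f cf r; apply (continuous_comp (fun r => f (xvar a r)) pr).
  - apply continuous_comp_xvar; auto.
  - apply continuous_coordinate; auto. }
assert (cY : forall r, continuous Y r) by (apply cpr; auto).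
assert (cZ : forall r, continuous Z r).
{ intros r; apply (continuous_opp (V := R_NormedModule) (fun r => pr (Dy (xvar a r)))), cpr; auto. }
assert (cW : forall r, continuous W r).
{ intros r; apply (continuous_mult (fun p => q (xvar a p) + k ^ 2)); auto.
  apply (continuous_plus (V := R_NormedModule) (fun p => q (xvar a p))); [| apply continuous_const].
  apply (continuous_comp_xvar a a0 q); auto. }
assert (DZ1 : forall r, is_derive (reg_Z a q pr k y Dy) r (W r)).
{ intros r; apply (is_derive_RInt_everywhere W); auto. }
assert (cZ1 : forall r, continuous (reg_Z a q pr k y Dy) r).
{ intros r; apply (ex_derive_continuous (reg_Z a q pr k y Dy)); eexists; apply DZ1. }
assert (DY1 : forall r, is_derive (reg_Y a q pr k y Dy) r (reg_Z a q pr k y Dy r)).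
{ intros r; apply (is_derive_RInt_everywhere (reg_Z a q pr k y Dy)); auto. }
(* [Z] has to come first: [reg_Y] is a primitive of [reg_Z], which must be recognized as [Z] before
   [Y] can be matched. *)
assert (EZ : forall r, 0 <= r <= length_T a -> reg_Z a q pr k y Dy r = Z r).
{ intros r hr; symmetry.
  rewrite (RInt_of_derive_open Z W (length_T a) r); auto.
  - unfold reg_Z, Z; rewrite xvar_0; auto.
  - intros t ht.
    destruct (S2 (xvar a t) (xvar_interior a a0 t ht)) as [D2 [cfd E]].
    assert (D := is_derive_opp (V := R_NormedModule) _ _ _ (cfd_derive a a0 Dy D2 pr t hpr ht cfd)).
    replace (W t) with (opp (- pr D2)); [exact D |].
    unfold opp; simpl; rewrite Ropp_involutive; unfold W, Y.
    destruct (y (xvar a t)) as [y1 y2], D2 as [d1 d2].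
    unfold Cplus, Copp, Cmult, lam_of, RtoC in E; simpl in E.
    injection E as E1 E2.
    destruct hpr as [-> | ->]; simpl; nra. }
assert (EY : forall r, 0 <= r <= length_T a -> reg_Y a q pr k y Dy r = Y r).
{ intros r hr; symmetry.
  rewrite (RInt_of_derive_open Y (reg_Z a q pr k y Dy) (length_T a) r); auto.
  - unfold reg_Y, Y; rewrite xvar_0; auto.
  - intros t ht; rewrite EZ by lra.
    apply (cfd_derive a a0 y _ pr t hpr ht), S1, xvar_interior; auto. }
split; [| auto].
intros r hr; split; [apply DY1 |].
rewrite (EY r hr); apply DZ1.
Qed.

(** * Numerator and denominator of the Weyl function at [- k ^ 2] *)

Section Weyl.
Variables (a : R) (q : R -> R) (h H : R) (phi Dphi psi Dpsi : R -> C -> C).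
Hypotheses (a0 : 0 < a) (cq : cont_on_Ipi q)
  (Hphi : is_phi a q h phi Dphi) (Hpsi : is_psi a q H psi Dpsi).
Let T := length_T a.
Let Q (r : R) : R := q (xvar a r).
Let Y (k : R) : R -> R :=
  reg_Y a q fst k (fun x => psi x (lam_of k)) (fun x => Dpsi x (lam_of k)).
Let Z (k : R) : R -> R :=
  reg_Z a q fst k (fun x => psi x (lam_of k)) (fun x => Dpsi x (lam_of k)).

Lemma psi_ode (k : R) : ode_sol T k Q (Y k) (Z k) /\ Y k 0 = 1 /\ Z k 0 = H.
Proof.
destruct (Hpsi (lam_of k)) as [S [e1 e2]].
destruct (reg_sol a q fst k _ _ a0 cq (or_introl eq_refl) S) as [O E].
pose proof (length_T_pos a a0).
destruct (E 0) as [E1 E2]; [lra |].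
rewrite xvar_0, e1 in E1 by auto; rewrite xvar_0, e2 in E2 by auto.
split; [exact O |]; unfold Y, Z; rewrite E1, E2; simpl; split; lra.
Qed.

(** The imaginary part of [psi] has zero data at [r = 0], so [ode_sol_zero] makes it vanish. *)
Lemma psi_zero_real (k : R) : psi 0 (lam_of k) = RtoC (Y k T).
Proof.
pose proof (length_T_pos a a0).
destruct (Hpsi (lam_of k)) as [S [e1 e2]].
destruct (reg_sol a q fst k _ _ a0 cq (or_introl eq_refl) S) as [_ E].
destruct (E T) as [E1 _]; [unfold T; lra |].
unfold T in E1; rewrite xvar_T in E1 by auto.
destruct (reg_sol a q snd k _ _ a0 cq (or_intror eq_refl) S) as [O' E'].
destruct (E' 0) as [F1 F2]; [lra |].
rewrite xvar_0, e1 in F1 by auto; rewrite xvar_0, e2 in F2 by auto; simpl in F1, F2.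
rewrite Ropp_0 in F2.
destruct (ode_sol_zero _ _ _ _ _ T (fun t => continuous_comp_xvar a a0 q t cq) O' F1 F2) as [G _]; [unfold T; lra |].
destruct (E' T) as [G1 _]; [unfold T; lra |].
unfold T in G, G1; rewrite xvar_T in G1 by auto; rewrite G in G1.
unfold Y, T; rewrite E1.
apply injective_projections; simpl; auto.
Qed.

(** [Delta] is a Wronskian of [phi] and [psi]. Moving its evaluation from [x = PI] to [x = 0], where
    the data of [phi] are known, leaves only [psi]; [phi] does not occur afterwards. *)
Lemma DeltaW_real (k : R) :
  DeltaW H phi Dphi (lam_of k) = RtoC (h * Y k T + Z k T).
Proof.
pose proof (length_T_pos a a0).
destruct (psi_ode k) as [O [Y0 Z0]].
destruct (Hphi (lam_of k)) as [S [e1 e2]].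
assert (W : forall pr, coordinate pr ->
  pr (Dphi PI (lam_of k)) + H * pr (phi PI (lam_of k)) =
  Y k T * pr (RtoC h) + Z k T * pr (RtoC 1)).
{ intros pr hpr.
  destruct (reg_sol a q pr k _ _ a0 cq hpr S) as [O' E].
  assert (V := ode_sol_wronskian _ _ _ _ _ _ _ (Rlt_le _ _ H0) O O').
  destruct (E 0) as [E1 E2]; [lra |].
  destruct (E T) as [E3 E4]; [unfold T; lra |].
  fold T in V; rewrite E1, E2, E3, E4, Y0, Z0 in V.
  unfold T in V at 2 4; rewrite xvar_0, xvar_T, e1, e2 in V by auto.
  lra. }
assert (W1 := W fst (or_introl eq_refl)); assert (W2 := W snd (or_intror eq_refl)).
unfold DeltaW.
destruct (Dphi PI (lam_of k)) as [d1 d2], (phi PI (lam_of k)) as [p1 p2].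
apply injective_projections; simpl in *; lra.
Qed.
End Weyl.

Theorem theorem1 (a : R) (q qt : R -> R) (h H ht Ht : R)
  (phi Dphi psi Dpsi phit Dphit psit Dpsit : R -> C -> C) :
  0 < a <= 1 ->
  cont_on_Ipi q -> cont_on_Ipi qt ->
  is_phi a q h phi Dphi -> is_psi a q H psi Dpsi ->
  is_phi a qt ht phit Dphit -> is_psi a qt Ht psit Dpsit ->
  (forall lam : C,
     DeltaW H phi Dphi lam <> RtoC 0 -> DeltaW Ht phit Dphit lam <> RtoC 0 ->
     Weyl H phi Dphi psi lam = Weyl Ht phit Dphit psit lam) ->
  (forall x, Ipi x -> q x = qt x) /\ h = ht /\ H = Ht.
Proof.
intros [a0 _] cq cqt Hphi Hpsi Hphit Hpsit HW.
assert (T0 := length_T_pos a a0).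
assert (cQ : forall t, continuous (fun r => q (xvar a r)) t)
  by (intros; apply (continuous_comp_xvar a a0 q); auto).
assert (cQt : forall t, continuous (fun r => qt (xvar a r)) t)
  by (intros; apply (continuous_comp_xvar a a0 qt); auto).
destruct (delta_nonzero (length_T a) H h _ T0 cQ) as [k1 [k1p nz1]].
destruct (delta_nonzero (length_T a) Ht ht _ T0 cQt) as [k2 [k2p nz2]].
assert (S1 := psi_ode a q H psi Dpsi a0 cq Hpsi).
assert (S2 := psi_ode a qt Ht psit Dpsit a0 cqt Hpsit).
assert (P1 := psi_zero_real a q H psi Dpsi a0 cq Hpsi).
assert (P2 := psi_zero_real a qt Ht psit Dpsit a0 cqt Hpsit).
assert (D1 := DeltaW_real a q h H phi Dphi psi Dpsi a0 cq Hphi Hpsi).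
assert (D2 := DeltaW_real a qt ht Ht phit Dphit psit Dpsit a0 cqt Hphit Hpsit).
cbv zeta in *.
set (Y := fun k => reg_Y a q fst k (fun x => psi x (lam_of k)) (fun x => Dpsi x (lam_of k))).
set (Z := fun k => reg_Z a q fst k (fun x => psi x (lam_of k)) (fun x => Dpsi x (lam_of k))).
set (Yt := fun k => reg_Y a qt fst k (fun x => psit x (lam_of k)) (fun x => Dpsit x (lam_of k))).
set (Zt := fun k => reg_Z a qt fst k (fun x => psit x (lam_of k)) (fun x => Dpsit x (lam_of k))).
destruct (schrodinger_weyl_uniqueness (length_T a) (Rmax k1 k2) H Ht h ht
  (fun r => q (xvar a r)) (fun r => qt (xvar a r)) Y Z Yt Zt) as [EQ [Eh EH]]; auto.
- apply Rlt_le_trans with k1; [auto | apply Rmax_l].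
- intros k _; apply S1.
- intros k _; apply S2.
- intros k hk.
  assert (hk1 : k1 <= k) by (eapply Rle_trans; [apply Rmax_l | exact hk]).
  assert (hk2 : k2 <= k) by (eapply Rle_trans; [apply Rmax_r | exact hk]).
  destruct (S1 k) as [O1 [I1 J1]], (S2 k) as [O2 [I2 J2]].
  assert (n1 := nz1 k _ _ hk1 O1 I1 J1); assert (n2 := nz2 k _ _ hk2 O2 I2 J2).
  specialize (HW (lam_of k)); unfold Weyl in HW.
  rewrite D1, D2, P1, P2 in HW.
  fold (Y k) (Z k) (Yt k) (Zt k) in n1, n2, HW.
  specialize (HW (fun e => n1 (RtoC_inj _ _ e)) (fun e => n2 (RtoC_inj _ _ e))).
  rewrite <- !RtoC_div, <- !RtoC_opp in HW by auto.
  apply RtoC_inj in HW.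
  set (d1 := h * Y k (length_T a) + Z k (length_T a)) in *.
  set (d2 := ht * Yt k (length_T a) + Zt k (length_T a)) in *.
  (* Clears denominators: [Y] becomes a quotient by [d1] in the shape of the left side of [HW]. *)
  replace (Y k (length_T a)) with (- - (Y k (length_T a) / d1) * d1) by (field; auto).
  rewrite HW; field; auto.
(* The potentials agree on the open interval so far; continuity gives the endpoints, hence equality
   at every point of [[0, PI]]. *)
- split; auto.
  assert (EV : forall r, 0 <= r <= length_T a -> q (xvar a r) = qt (xvar a r)).
  { intros r hr; apply Rminus_diag_uniq.
    apply (eq_zero_closed_of_open (fun r => q (xvar a r) - qt (xvar a r)) (length_T a)); auto.
    - intros t; apply (continuous_minus (V := R_NormedModule)
        (fun r => q (xvar a r)) (fun r => qt (xvar a r))); auto.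
    - intros t ht'; rewrite (EQ t ht'); ring. }
  intros x [[x0 | <-] [x1 | ->]].
  + destruct (xvar_surj a a0 x (conj x0 x1)) as [r [hr <-]]; apply EV; lra.
  + rewrite <- (xvar_0 a a0); apply EV; lra.
  + rewrite <- (xvar_T a a0); apply EV; lra.
  + rewrite <- (xvar_0 a a0); apply EV; lra.
Qed.
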